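(* Let $k\ge 2$ and let $a_1\ge a_2\ge\cdots\ge a_k\ge 1$ be integers with $a_1\ge 2$, and put $t=\sum_{i=1}^k a_i$. Let $G$ be an $F_{a_1,\dots,a_k}$-free graph of order $n\ge 8t^2-12t+9$. Then $q(G)\le q(S_{n,t})$, with equality if and only if $G\cong S_{n,t}$.
   Context: All graphs are finite, simple and undirected. For a graph $G$, $Q(G)=D(G)+A(G)$ is its signless Laplacian matrix ($D(G)$ the diagonal degree matrix, $A(G)$ the adjacency matrix), and $q(G)$ denotes the largest eigenvalue of $Q(G)$. $F_{a_1,\dots,a_k}$ is the graph consisting of $k$ cycles of odd lengths $2a_1+1,\dots,2a_k+1$ which pairwise intersect in exactly one common vertex (shared by all of them). A graph is $H$-free if it contains no subgraph isomorphic to $H$. $S_{n,t}$ denotes the join $K_t\nabla\overline{K}_{n-t}$, i.e. a clique on $t$ vertices with every vertex joined to each vertex of an independent set of $n-t$ vertices. *)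

(* Defs.v *)
From HB Require Import structures.
From mathcomp Require Import all_boot all_order all_algebra.
From mathcomp Require Import fingroup perm reals.
Set Implicit Arguments. Unset Strict Implicit. Unset Printing Implicit Defensive.
Import Order.TTheory GRing.Theory Num.Theory.
Local Open Scope ring_scope.

Definition simple_graph (n : nat) (e : rel 'I_n) : Prop :=
  symmetric e /\ irreflexive e.

Definition deg (n : nat) (e : rel 'I_n) (v : 'I_n) : nat := #|[set u | e v u]|.

Definition degmx (R : realType) (n : nat) (e : rel 'I_n) : 'M[R]_n :=
  \matrix_(i, j) (if i == j then (deg e i)%:R else 0).
Definition adjmx (R : realType) (n : nat) (e : rel 'I_n) : 'M[R]_n :=
  \matrix_(i, j) (if e i j then 1 else 0).
Definition signlessQ (R : realType) (n : nat) (e : rel 'I_n) : 'M[R]_n :=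
  degmx R e + adjmx R e.

Definition is_largest_eigenvalue (R : realType) (n : nat) (A : 'M[R]_n) (l : R)
  : Prop :=
  eigenvalue A l /\ (forall m, eigenvalue A m -> m <= l).

Definition is_q (R : realType) (n : nat) (e : rel 'I_n) (l : R) : Prop :=
  is_largest_eigenvalue (signlessQ R e) l.

Definition contains_subgraph (V : finType) (eH : rel V) (n : nat) (e : rel 'I_n)
  : Prop :=
  exists f : V -> 'I_n, injective f /\ (forall x y, eH x y -> e (f x) (f y)).
Definition H_free (V : finType) (eH : rel V) (n : nat) (e : rel 'I_n) : Prop :=
  ~ contains_subgraph eH e.

(* The friendship-type graph F_{a_1,...,a_k}: a center (None) and, for each
   i < k, a path Some(i,0) - ... - Some(i,2 a_i - 1) whose two ends are joined
   to the center, giving a cycle of length 2 a_i + 1 through the center. *)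
Definition F_vert (k : nat) (a : 'I_k -> nat) : finType :=
  option {i : 'I_k & 'I_(2 * a i)}.

Definition F_end (k : nat) (a : 'I_k -> nat) (u : {i : 'I_k & 'I_(2 * a i)})
  : bool :=
  (val (tagged u) == 0)%N || (val (tagged u) == (2 * a (tag u)).-1)%N.

Definition F_edge (k : nat) (a : 'I_k -> nat) : rel (F_vert a) :=
  fun x y =>
    match x, y with
    | None, None => false
    | None, Some u => F_end u
    | Some u, None => F_end u
    | Some u, Some v =>
        (tag u == tag v) &&
        (((val (tagged u)).+1 == val (tagged v))%N ||
         ((val (tagged v)).+1 == val (tagged u))%N)
    end.

(* S_{n,t} = K_t \/ complement(K_{n-t}) on 'I_n: vertices < t form the clique *)
Definition S_edge (n t : nat) : rel 'I_n :=
  fun i j => (i != j) && ((val i < t)%N || (val j < t)%N).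

Definition graph_iso (n : nat) (e1 e2 : rel 'I_n) : Prop :=
  exists p : {perm 'I_n}, forall x y, e1 x y = e2 (p x) (p y).

(* Main.v *)
(** With c = 2t - 5/2, q(S_{n,t}) is at least n + c, so a graph with
    q(G) >= q(S_{n,t}) has, by comparing an eigenvector with the degrees, a
    vertex u whose neighbourhood N satisfies
      sum_(v in N) (deg_N v - M v - c) >= 0,
    where M v counts the vertices at distance 2 or more from u that v misses.
    A minimal nonempty K in N with this property is connected, has minimum
    degree at least t - 1, and contains no two adjacent vertices of degree
    t - 1.  As G is fan-free, K has no path on 2t vertices; |K| = 2t - 1 is
    impossible, since K would be so dense that it could be extended to a fan.
    Rotating a path on 2t - 1 vertices then shows that K has t - 1 vertices E
    which form the neighbourhood in K of every other vertex of K.  It follows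
    that u is adjacent to all vertices and that G differs little from the complete split
    graph on u + E.  The Perron vector of S_{n,t} is then a subeigenvector of
    Q(G), and it is an eigenvector only if G is S_{n,t}. *)

Require Import Defs.
From HB Require Import structures.
From mathcomp Require Import all_boot all_order all_algebra.
From mathcomp Require Import fingroup perm reals.
From mathcomp Require Import zify ring lra.
Import Order.TTheory GRing.Theory Num.Theory.
Local Open Scope nat_scope.

(** * Dense vertex sets and long paths inside them *)

Section Graph.
Context {T : finType} (e : rel T).
Hypotheses (e_sym : symmetric e) (e_irr : irreflexive e).
Implicit Types (S K A B : {set T}) (u v x y : T) (s p : seq T).

Definition nbrs S v : {set T} := [set w in S | e v w].

Lemma card_nbrs S v : #|nbrs S v| = \sum_(w in S) e v w.
Proof.
rewrite -sum1_card /nbrs (eq_bigl (fun w => (w \in S) && e v w)); last first.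
  by move=> w; rewrite inE.
by rewrite big_mkcondr; apply: eq_bigr => w _; case: (e v w).
Qed.

Lemma nbrs_subset S v : nbrs S v \subset S.
Proof. by apply/subsetP=> w; rewrite inE => /andP[]. Qed.

Lemma leq_card_nbrs S v : #|nbrs S v| <= #|S|.
Proof. exact/subset_leq_card/nbrs_subset. Qed.

Lemma sum_subset_split {S A} (F : T -> nat) : A \subset S ->
  \sum_(v in S) F v = \sum_(v in A) F v + \sum_(v in S :\: A) F v.
Proof. by move=> sAS; rewrite (big_setID A) (setIidPr sAS). Qed.

Lemma card_nbrs_split {S A} v : A \subset S ->
  #|nbrs S v| = #|nbrs A v| + #|nbrs (S :\: A) v|.
Proof. by move=> sAS; rewrite !card_nbrs (sum_subset_split _ sAS). Qed.

Lemma sum_card_nbrsC A B :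
  \sum_(v in A) #|nbrs B v| = \sum_(v in B) #|nbrs A v|.
Proof.
under eq_bigr do rewrite card_nbrs.
rewrite exchange_big; apply: eq_bigr => v _; rewrite card_nbrs.
by apply: eq_bigr => w _; rewrite e_sym.
Qed.

(* For w v = 4t - 5 + 2 M v this is the inequality of the header, doubled to
   stay in nat. *)
Definition dense (w : T -> nat) S : bool :=
  \sum_(v in S) w v <= 2 * \sum_(v in S) #|nbrs S v|.

Lemma sum_deg_split {S A} : A \subset S ->
  \sum_(v in S) #|nbrs S v| =
  \sum_(v in A) #|nbrs A v| + 2 * \sum_(v in A) #|nbrs (S :\: A) v|
  + \sum_(v in S :\: A) #|nbrs (S :\: A) v|.
Proof.
move=> sAS; rewrite (sum_subset_split _ sAS).
under eq_bigr do rewrite (card_nbrs_split _ sAS).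
under [X in _ + X]eq_bigr do rewrite (card_nbrs_split _ sAS).
rewrite !big_split /= (sum_card_nbrsC (S :\: A) A); lia.
Qed.

Definition cut_connected K := forall A, A \subset K -> A != set0 -> A != K ->
  exists x y, [/\ x \in A, y \in K :\: A & e x y].

(** [K] is an inclusion-minimal nonempty dense subset. For a proper nonempty part [A], neither [A]
    nor [K :\: A] is dense; subtracting the second failure from the density of [K] bounds from below
    the degrees lost by deleting [A]. The three conclusions take for [A] one side of a cut, a single
    vertex, and the two ends of an edge. *)
Lemma dense_core (w : T -> nat) S :
  S != set0 -> dense w S -> (forall v, v \in S -> 0 < w v) ->
  exists K, [/\ K \subset S, K != set0 & dense w K] /\ [/\ cut_connected K,
    (forall v, v \in K -> w v < 4 * #|nbrs K v|) &
    (forall x y, x \in K -> y \in K -> e x y -> 2 < #|K| ->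
       w x + w y + 4 < 4 * (#|nbrs K x| + #|nbrs K y|))].
Proof.
move=> S0 dS w0.
have [K /minsetP[/and3P[sKS K0 dK] minK] _] :=
  minset_exists (P := fun A => [&& A \subset S, A != set0 & dense w A])
    (introT and3P (And3 (subxx S) S0 dS)).
have small A : A \subset K -> A != set0 -> A != K ->
    2 * \sum_(v in A) #|nbrs A v| < \sum_(v in A) w v.
  move=> sAK A0 AK; rewrite ltnNge; apply/negP => dA.
  case/eqP: AK; apply: minK => //; apply/and3P; split=> //.
  exact: subset_trans sAK sKS.
have remove A : A \subset K -> A != set0 -> A != K -> \sum_(v in A) w v
    < 2 * \sum_(v in A) #|nbrs A v| + 4 * \sum_(v in A) #|nbrs (K :\: A) v|.
  move=> sAK A0 AK.
  have := small (K :\: A) (subsetDl _ _).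
  rewrite setD_eq0 => /(_ _ _) H.
  have {}H : 2 * \sum_(v in K :\: A) #|nbrs (K :\: A) v|
      < \sum_(v in K :\: A) w v.
    apply: H; first by apply: contra AK => sKA; rewrite eqEsubset sAK.
    apply: contra A0 => /eqP/setDidPl; rewrite disjoint_sym => /disjoint_setI0.
    by rewrite (setIidPl sAK) => ->.
  move: dK; rewrite /dense (sum_subset_split _ sAK) (sum_deg_split sAK); lia.
exists K; split=> //; split.
- move=> A sAK A0 AK.
  case: (boolP [exists x in A, exists y in K :\: A, e x y]) => [|noedge].
    by case/exists_inP=> x xA /exists_inP[y yK exy]; exists x, y.
  have z : \sum_(v in A) #|nbrs (K :\: A) v| = 0.
    apply: big1 => v vA; apply/eqP; rewrite cards_eq0; apply: contraNT noedge.
    case/set0Pn=> y; rewrite inE => /andP[yK evy].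
    by apply/exists_inP; exists v => //; apply/exists_inP; exists y.
  have := remove A sAK A0 AK; rewrite z.
  have := small A sAK A0 AK; lia.
- move=> v vK.
  have nvv : #|nbrs [set v] v| = 0 by rewrite card_nbrs big_set1 e_irr.
  have sv : [set v] \subset K by rewrite sub1set.
  (* A one-vertex [K] spans no edge, so its density would contradict [0 < w v]. *)
  case: (eqVneq [set v] K) => [vE|vnK].
    move: dK; rewrite /dense -vE !big_set1 nvv.
    have := w0 v (subsetP sKS v vK); lia.
  have := remove [set v] sv _ vnK; rewrite !big_set1 nvv (card_nbrs_split _ sv).
  rewrite nvv => /(_ _) H; suff: [set v] != set0 by move/H; lia.
  by apply/set0Pn; exists v; rewrite set11.
- move=> x y xK yK exy K2.
  have xy : x != y by apply: contraTneq exy => ->; rewrite e_irr.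
  have sA : [set x; y] \subset K by apply/subsetP=> z /set2P[]->.
  have AK : [set x; y] != K.
    by apply: contraTneq K2 => <-; rewrite cards2 xy.
  have A0 : [set x; y] != set0 by apply/set0Pn; exists x; rewrite set21.
  have sum2 F : \sum_(v in [set x; y]) F v = F x + F y.
    by rewrite big_setU1 ?big_set1 // inE.
  have := remove _ sA A0 AK; rewrite !sum2 !(card_nbrs_split _ sA).
  rewrite !(card_nbrs [set x; y]) !sum2 !e_irr (e_sym y x) exy; lia.
Qed.

Lemma rev_path_sym h p : path e (last h p) (rev (belast h p)) = path e h p.
Proof. by rewrite rev_path; apply: eq_path => x y; rewrite /= e_sym. Qed.

(** This is the pigeonhole step of the Dirac and Ore theorems. [belast h p] lists the predecessors
    of the entries of [p], so without a crossing each position is counted at most once. *)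
Lemma crossing_or_count (a b : pred T) h p :
  (exists p1 z p2, [/\ p = p1 ++ z :: p2, a z & b (last h p1)]) \/
  count a p + count b (belast h p) <= size p.
Proof.
elim: p h => [|z p IH] h; first by right.
case: (boolP (a z && b h)) => [/andP[az bh]|ab].
  by left; exists [::], z, p.
case: (IH z) => [[p1 [z' [p2 [-> az' bl]]]]|IHc].
  by left; exists (z :: p1), z', p2.
right; rewrite /= ; case: (a z) (b h) ab => [] [] //= _; lia.
Qed.

(* Two crossing edges from the ends of a path close it into a cycle, which can
   be cut open at any vertex that has a neighbour elsewhere. *)
Lemma path_extend h p x y :
  path e h p -> uniq (h :: p) -> x \in h :: p -> y \notin h :: p -> e x y ->
  size p < count (e h) (h :: p) + count (e (last h p)) (h :: p) ->
  exists2 s, sorted e s & perm_eq s (y :: h :: p).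
Proof.
move=> hp up xs ys exy big.
case: (crossing_or_count (e h) (e (last h p)) h p) => [|few]; last first.
  move: big; rewrite [X in _ + count _ X]lastI -cats1 count_cat /= !e_irr; lia.
case=> p1 [z [p2 [pE ehz el]]]; subst p; rewrite last_cat /= in el.
(* The cycle follows the path from [h] through [p1], jumps to the last vertex [l], runs backwards to
   [z] and closes with the edge from [z] to [h]. *)
pose l := last z p2; pose c := h :: p1 ++ l :: rev (belast z p2).
have revE : l :: rev (belast z p2) = rev (z :: p2).
  by rewrite [z :: p2]lastI rev_rcons.
have cyc : path.cycle e c.
  have lastE : last h (p1 ++ l :: rev (belast z p2)) = z.
    by rewrite last_cat revE rev_cons last_rcons.
  rewrite /c /= rcons_path lastE cat_path /=.
  move: hp; rewrite cat_path /= => /and3P[-> _ zp2] /=.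
  by rewrite e_sym el rev_path_sym zp2 /= e_sym.
have perm_c : perm_eq c (h :: p1 ++ z :: p2).
  by rewrite /c revE perm_cons perm_cat2l perm_rev.
have [i s rotE] := rot_to (etrans (perm_mem perm_c x) xs).
exists (y :: x :: s).
  move: cyc; rewrite -(rot_cycle i) rotE /= rcons_path (e_sym y) exy /=.
  by case/andP.
by rewrite perm_cons -rotE (perm_trans _ perm_c) // perm_rot.
Qed.

Definition path_in K s := [&& sorted e s, uniq s & all [in K] s].

Lemma path_in_sub {K S s} : K \subset S -> path_in K s -> path_in S s.
Proof.
move=> /subsetP sKS /and3P[ss us /allP aK]; apply/and3P; split=> //.
by apply/allP=> x /aK /sKS.
Qed.

Lemma card_nbrs_count K s v : uniq s -> {subset nbrs K v <= s} ->
  #|nbrs K v| <= count (e v) s.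
Proof.
move=> us sub; rewrite -size_filter -(card_uniqP (filter_uniq _ us)).
apply/subset_leq_card/subsetP=> w wn; rewrite mem_filter sub // andbT.
by move: wn; rewrite inE => /andP[].
Qed.

(** The path is prolonged at its front or its back if possible. Otherwise both ends have all their
    neighbours on it, and a large degree sum lets [path_extend] absorb a vertex across an edge that
    leaves the path; such an edge exists by connectivity. *)
Lemma path_step K h p :
  cut_connected K -> path_in K (h :: p) -> size (h :: p) < #|K| ->
  (exists2 s, path_in K s & size s = (size p).+2) \/
  [/\ {subset nbrs K h <= h :: p}, {subset nbrs K (last h p) <= h :: p}
    & #|nbrs K h| + #|nbrs K (last h p)| <= size p].
Proof.
move=> conn pin ltK; have /and3P[hp us aK] := pin.
have subn_or v : v \in h :: p ->
    (exists2 y, y \notin h :: p & (y \in K) && e v y)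
    \/ {subset nbrs K v <= h :: p}.
  move=> vs; case: (boolP [exists y, (y \notin h :: p) && ((y \in K) && e v y)]).
    by case/existsP=> y /andP[? ?]; left; exists y.
  rewrite negb_exists => /forallP no; right=> y; rewrite inE => yn.
  by move: (no y); rewrite yn andbT negbK.
case: (subn_or h (mem_head _ _)) => [[y ys /andP[yK ehy]]|nh].
  left; exists (y :: h :: p) => //; apply/and3P; split.
  - by rewrite /= e_sym ehy.
  - by rewrite cons_uniq ys.
  - by rewrite /= yK.
case: (subn_or _ (mem_last h p)) => [[y ys /andP[yK ely]]|nl].
  left; exists (rcons (h :: p) y); last by rewrite size_rcons.
  apply/and3P; split.
  - by rewrite /= rcons_path ely andbT.
  - by rewrite rcons_uniq ys.
  - by rewrite all_rcons /= yK.
case: (leqP (#|nbrs K h| + #|nbrs K (last h p)|) (size p)) => [?|big].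
  by right.
left; have [x [y [xs /setDP[yK ys] exy]]] :
    exists x y, [/\ x \in [set:: h :: p], y \in K :\: [set:: h :: p] & e x y].
  apply: conn; first by apply/subsetP=> v; rewrite inE => /(allP aK).
    by apply/set0Pn; exists h; rewrite inE mem_head.
  apply: contraTneq ltK => <-; rewrite -leqNgt.
  by rewrite cardsE (card_uniqP us).
rewrite inE in xs; rewrite inE in ys.
have [|s ss pe] := path_extend h p x y hp us xs ys exy.
  apply: leq_trans big _.
  by rewrite leq_add // card_nbrs_count.
exists s; last by rewrite (perm_size pe).
apply/and3P; split=> //; first by rewrite (perm_uniq pe) cons_uniq ys.
by rewrite (perm_all _ pe) /= yK.
Qed.

(** The path grows by one vertex at a time: while it has at most 2d vertices, the degree sum 2d of
    its ends rules out the second outcome of [path_step]. *)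
Lemma long_path K d m : K != set0 -> cut_connected K ->
  (forall v, v \in K -> d <= #|nbrs K v|) ->
  0 < m <= #|K| -> m <= 2 * d + 1 -> exists2 s, path_in K s & size s = m.
Proof.
move=> K0 conn degd; elim: m => [//|m IH] /andP[_ mK md].
case: m IH mK md => [|m] IH mK md.
  by have /set0Pn[x xK] := K0; exists [:: x]; rewrite // /path_in /= xK.
have [||s pin ss] := IH; [lia|lia|].
case: s pin ss => [//|h p] pin [sp].
have hK v : v \in h :: p -> v \in K by case/and3P: pin => _ _ /allP; apply.
case: (path_step K h p conn pin) => [|[s ? ?]|[_ _]].
- by rewrite /= sp.
- by exists s; rewrite // -sp.
- have := degd h (hK _ (mem_head _ _)).
  have := degd (last h p) (hK _ (mem_last _ _)); lia.
Qed.

(* A weak form of the Erdos-Gallai theorem, off by 1/2 in the average degree. *)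
Lemma weak_erdos_gallai S m : 1 < m -> S != set0 ->
  (forall s, path_in S s -> size s <> m) ->
  2 * \sum_(v in S) #|nbrs S v| < #|S| * (2 * m - 3).
Proof.
move=> m1 S0 nopath; rewrite ltnNge; apply/negP => big.
(* With this constant weight a core has degrees above (2m - 3)/4, hence at least [m./2], and 2 *
   [m./2] + 1 >= m is what [long_path] asks for. A core on fewer than m vertices would have degrees
   at most m - 2, too few to be dense. *)
have dS : dense (fun=> 2 * m - 3) S by rewrite /dense sum_nat_const.
have [|K [[sKS K0 dK] [conn degK _]]] := dense_core _ S S0 dS.
  by move=> *; lia.
have mK : m <= #|K|.
  rewrite leqNgt; apply/negP => Km.
  have : \sum_(v in K) #|nbrs K v| <= \sum_(v in K) (m - 2).
    apply: leq_sum => v vK.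
    have : #|nbrs K v| < #|K|; last lia.
    apply: proper_card; rewrite properE nbrs_subset; apply/subsetPn.
    by exists v => //; rewrite inE e_irr andbF.
  have K0' : 0 < #|K| by rewrite card_gt0.
  move: dK; rewrite /dense !sum_nat_const; nia.
have degK' v : v \in K -> m./2 <= #|nbrs K v| by move=> /degK; lia.
have [||s pin ss] := long_path K m./2 m K0 conn degK'; [lia|lia|].
exact: nopath (path_in_sub sKS pin) ss.
Qed.

End Graph.

(** * Alternating paths and the structure of a large core *)

Fixpoint alternate {T : Type} (s1 s2 : seq T) : seq T :=
  if s1 is x :: s1' then if s2 is y :: s2' then x :: y :: alternate s1' s2'
  else [::] else [::].

Lemma perm_alternate {T : eqType} (s1 s2 : seq T) : size s1 = size s2 ->
  perm_eq (alternate s1 s2) (s1 ++ s2).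
Proof.
elim: s1 s2 => [|x s1 IH] [|y s2] //= [/IH pe].
by rewrite perm_cons perm_sym perm_catC cat_cons perm_cons perm_catC perm_sym.
Qed.

Lemma path_alternate {T : eqType} (e : rel T) z (s1 s2 : seq T) :
  symmetric e ->
  {in s1 & s2, forall x y, e x y} -> size s1 = size s2 ->
  (s1 <> [::] -> e z (head z s1)) -> path e z (alternate s1 s2).
Proof.
move=> e_sym; elim: s1 s2 z => [|x s1 IH] [|y s2] //= z cross [ss] ezx.
rewrite ezx // cross ?mem_head //= IH //.
  by move=> a b sa sb; apply: cross; rewrite inE ?sa ?sb orbT.
case: s1 {IH ezx ss} cross => [|a s1] //= cross _.
by rewrite e_sym cross // !inE eqxx ?orbT.
Qed.

(** Passing to the predecessor is injective on the positions of a path. *)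
Lemma count_leq_belast {T : Type} (a b : pred T) h (p : seq T) :
  (forall p1 z p2, p = p1 ++ z :: p2 -> a z -> b (last h p1)) ->
  count a p <= count b (belast h p).
Proof.
elim: p h => [//|z p IH] h ab /=; apply: leq_add.
  by have := ab [::] z p erefl; case: (a z) => //= ->.
by apply: IH => p1 y p2 pE; apply: (ab (z :: p1) y p2); rewrite pE.
Qed.

Section LargeCore.
Context {T : finType} (e : rel T).
Hypotheses (e_sym : symmetric e) (e_irr : irreflexive e).
Variables (r : nat) (K : {set T}).
Hypotheses (r_gt0 : 0 < r) (K_conn : cut_connected e K).
Hypothesis K_deg : forall v, v \in K -> r <= #|nbrs e K v|.
Hypothesis K_deg2 : forall x y, x \in K -> y \in K -> e x y ->
  2 * r < #|nbrs e K x| + #|nbrs e K y|.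
Hypothesis K_large : 2 * r + 2 <= #|K|.
Hypothesis K_path : forall s, path_in e K s -> size s <> 2 * r + 2.

Lemma low_indep x y : x \in K -> #|nbrs e K x| = r -> #|nbrs e K y| = r ->
  y \in K -> ~~ e x y.
Proof.
move=> xK dx dy yK; apply/negP => /(K_deg2 x y xK yK); rewrite dx dy; lia.
Qed.

(** A path on 2r + 1 vertices cannot grow, so [path_step] bounds the degree sum of its ends by 2r,
    while each degree is at least r. *)
Lemma longest_path_ends h p : path_in e K (h :: p) -> size p = 2 * r ->
  [/\ {subset nbrs e K h <= h :: p}, {subset nbrs e K (last h p) <= h :: p},
      #|nbrs e K h| = r & #|nbrs e K (last h p)| = r].
Proof.
move=> pin sp; have /and3P[_ _ /allP aK] := pin.
have dh := K_deg h (aK _ (mem_head _ _)).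
have dl := K_deg (last h p) (aK _ (mem_last _ _)).
case: (path_step e e_sym e_irr K h p K_conn pin) => [|[s pin' ss]|[]].
- by rewrite /= sp; lia.
- by case: (K_path s pin'); lia.
- by move=> nh nl le; split=> //; lia.
Qed.

(** [E] is the neighbourhood of an end [h] of a path on 2r + 1 vertices. Rotations show that the
    path consists of [E] and r + 1 vertices with neighbourhood [E]; connectivity then extends this
    to all of [K]. *)
Lemma large_core_structure : exists E : {set T}, [/\ E \subset K, #|E| = r &
  forall x, x \in K :\: E -> nbrs e K x = E].
Proof.
have K0 : K != set0 by rewrite -card_gt0; lia.
have [||[|h p] pin /= sp] :=
    long_path e e_sym e_irr K r (2 * r + 1) K0 K_conn K_deg; [lia|lia|lia|].
have {}sp : size p = 2 * r by lia.
set E := nbrs e K h; set s := h :: p in pin.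
have /and3P[hp us /allP aK] := pin.
have [nh nl dh dl] := longest_path_ends h p pin sp.
have hK : h \in K := aK _ (mem_head _ _).
pose b x := (#|nbrs e K x| == r) && all [in s] (enum (nbrs e K x)).
have bP x : #|nbrs e K x| = r -> {subset nbrs e K x <= s} -> b x.
  by move=> dx nx; rewrite /b dx eqxx; apply/allP=> y; rewrite mem_enum => /nx.
(* Posa rotation: as [h] is adjacent to [z], reversing the segment before [z] gives a path on the
   same vertices that starts at the predecessor of [z]. *)
have ab p1 z p2 : p = p1 ++ z :: p2 -> z \in E -> b (last h p1).
  move=> pE /[!inE] /andP[zK ehz].
  have perm_r : perm_eq (rev (h :: p1) ++ z :: p2) s.
    have -> : s = (h :: p1) ++ z :: p2 by rewrite cat_cons -pE.
    by rewrite perm_cat2r perm_rev.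
  have pin' : path_in e K (rev (h :: p1) ++ z :: p2).
    apply/and3P; split; last by rewrite (perm_all _ perm_r); apply/allP.
      move: hp; rewrite /s pE /= cat_path /= => /and3P[hp1 _ zp2].
      rewrite [h :: p1]lastI rev_rcons /= cat_path rev_path_sym // hp1 /= zp2.
      suff -> : last (last h p1) (rev (belast h p1)) = h by rewrite ehz.
      by case: p1 {pE perm_r hp1} => [|a p1] //=; rewrite rev_cons last_rcons.
    by rewrite (perm_uniq perm_r).
  move: pin' perm_r; rewrite [h :: p1]lastI rev_rcons cat_cons => pin' perm_r.
  have [|nx _ dx _] := longest_path_ends _ _ pin'.
    by move: (perm_size perm_r) => /= -[->].
  by apply: bP => // y /nx; rewrite (perm_mem perm_r).
have cE : count [in E] s = r.
  apply/eqP; rewrite eqn_leq; apply/andP; split; last first.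
    rewrite -dh -size_filter -(card_uniqP (filter_uniq _ us)).
    apply/subset_leq_card/subsetP=> y yE; rewrite mem_filter /= yE.
    exact: nh.
  rewrite -dh -size_filter -(card_uniqP (filter_uniq _ us)).
  by apply/subset_leq_card/subsetP=> y; rewrite mem_filter => /andP[].
have Eb y : y \in s -> b y -> y \notin E.
  move=> ys /andP[/eqP dy _]; rewrite inE (aK _ ys) /=.
  exact: low_indep (aK _ ys).
(* The r vertices of [E] have r predecessors satisfying [b], and the last vertex satisfies [b] as
   well. Since [E] and [b] are disjoint on the path, they account for all its 2r + 1 vertices. *)
have Eorb : all (predU [in E] b) s.
  rewrite all_count; apply/eqP; have := count_predUI [in E] b s.
  have -> : count (predI [in E] b) s = 0.
    apply/eqP; rewrite -leqn0 leqNgt -has_count; apply/hasP => -[y ys /andP[yE]].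
    by move/(Eb y ys); rewrite yE.
  have := count_leq_belast [in E] b h p ab.
  move: cE; rewrite /s /= [h \in E]inE e_irr andbF add0n => cE.
  have := bP _ dl nl.
  have : count b (h :: p) = count b (belast h p) + b (last h p).
    by rewrite lastI -cats1 count_cat /= addn0.
  have := count_size (predU [in E] b) (h :: p).
  by rewrite /= sp => *; lia.
have bE x : x \in s -> b x -> nbrs e K x = E.
  move=> xs bx; have /andP[/eqP dx /allP nx] := bx.
  apply/eqP; rewrite eqEcard dx dh leqnn andbT; apply/subsetP=> y ny.
  have ys : y \in s by apply: nx; rewrite mem_enum.
  have /orP[//|/andP[/eqP dy _]] := allP Eorb _ ys.
  move: ny; rewrite inE => /andP[yK exy].
  by case/negP: (low_indep x y (aK _ xs) dx dy yK).
pose X := [set v in K | nbrs e K v == E].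
have lowX x : x \in X -> #|nbrs e K x| = r.
  by rewrite inE => /andP[_ /eqP ->].
have XK x : x \in X -> x \in K by rewrite inE => /andP[].
have sEX : {subset s <= E :|: X}.
  move=> x xs; rewrite !inE aK //=; have /orP[|/(bE x xs) ->] := allP Eorb _ xs.
    by rewrite /= inE => /andP[_ ->].
  by rewrite eqxx orbT.
have EXdisj : [disjoint E & X].
  apply/pred0P => x /=; apply/negP => /andP[+ xX].
  by rewrite inE => /andP[xK ehx]; case/negP: (low_indep h x hK dh (lowX _ xX) xK).
have cX : r < #|X|.
  have : #|[set:: s]| <= #|E :|: X|.
    by apply/subset_leq_card/subsetP=> x; rewrite inE => /sEX.
  rewrite cardsE (card_uniqP us) cardsU (disjoint_setI0 EXdisj) cards0 /= sp dh.
  lia.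
(* An edge leaving [E :|: X] must start at some [x] in [E] and end at some [y]. Putting [y] before a
   path that begins at [x] and alternates between [E] and [X] gives 2r + 1 vertices. Hence [y] has
   degree r and no neighbour in [X], so its neighbourhood is [E] and it belongs to [X] after all. *)
have EX : E :|: X = K.
  apply/eqP/negPn/negP => neq.
  have [||x [y [xEX /setDP[yK yEX] exy]]] := K_conn (E :|: X) _ _ neq.
  - by rewrite subUset nbrs_subset; apply/subsetP.
  - by apply/set0Pn; exists h; apply: sEX; apply: mem_head.
  case/setUP: xEX => [xE|/[!inE] /andP[xK /eqP nx]]; last first.
    by case/negP: yEX; rewrite inE -nx inE yK exy.
  pose es := x :: enum (E :\ x); pose xs := take r (enum X).
  have esE : es =i E.
    by move=> z; rewrite in_cons mem_enum in_setD1; case: eqP => [->|].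
  have ues : uniq es by rewrite /= mem_enum in_setD1 eqxx enum_uniq.
  have ses : size es = r by rewrite -(card_uniqP ues) (eq_card esE).
  have sxs : size xs = r by rewrite size_take -cardE cX.
  have xsX z : z \in xs -> z \in X by move/mem_take; rewrite mem_enum.
  have perm_a := perm_alternate es xs (etrans ses (esym sxs)).
  have mem_a z : z \in alternate es xs -> z \in E :|: X.
    by rewrite (perm_mem perm_a) mem_cat esE in_setU => /orP[->|/xsX ->]; rewrite ?orbT.
  have pin' : path_in e K (y :: alternate es xs).
    apply/and3P; split.
    - apply: path_alternate; rewrite ?ses ?sxs //=; last by rewrite e_sym.
      move=> a c; rewrite esE => + /xsX; rewrite [c \in X]inE => aE /andP[_ /eqP nc].
      by move: aE; rewrite -nc inE e_sym => /andP[].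
    - rewrite cons_uniq (contra (mem_a _) yEX) (perm_uniq perm_a) cat_uniq ues.
      rewrite take_uniq ?enum_uniq // andbT /=; apply/hasPn => z /xsX zX.
      rewrite /= esE; apply: contraTN zX => zE.
      by rewrite (disjointFr EXdisj zE).
    - rewrite /= yK; apply/allP => z /mem_a /setUP[|/XK //].
      exact/subsetP/nbrs_subset.
  have [|ny _ dy _] := longest_path_ends _ _ pin'.
    by rewrite (perm_size perm_a) size_cat ses sxs mul2n addnn.
  case/negP: yEX; rewrite inE; apply/orP; right; rewrite inE yK eqEcard dy dh.
  rewrite leqnn andbT; apply/subsetP=> z nz; have := ny z nz.
  move: nz; rewrite inE => /andP[zK eyz]; rewrite inE.
  case/orP=> [/eqP zy|/mem_a /setUP[//|/lowX dz]].
    by rewrite zy e_irr in eyz.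
  by case/negP: (low_indep y z yK dy dz zK).
exists E; split=> //; first exact: nbrs_subset.
move=> x /setDP[xK xE]; have : x \in E :|: X by rewrite EX.
by rewrite in_setU (negbTE xE) inE => /andP[_ /eqP].
Qed.

End LargeCore.

(** * Embedding a fan along two paths *)

Section FanEmbedding.
Variables (k : nat) (a : 'I_k -> nat).

(** The position where petal [i], the i-th cycle without the centre, starts when the petals are laid
    end to end. *)
Definition fan_offset (i : 'I_k) := \sum_(j < k | j < i) 2 * a j.

Lemma fan_offset_leq (P : pred 'I_k) (i : 'I_k) : P i ->
  (forall j : 'I_k, j < i -> P j) ->
  fan_offset i + 2 * a i <= \sum_(j < k | P j) 2 * a j.
Proof.
move=> Pi Plt; rewrite (bigD1 i) //= addnC leq_add2l /fan_offset.
rewrite big_mkcond [leqRHS]big_mkcond; apply: leq_sum => j _.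
case: ifP => // ji; rewrite Plt //=.
by rewrite ifT //; apply: contraTneq ji => ->; rewrite ltnn.
Qed.

Lemma fan_offset_lt (i j : 'I_k) : i < j ->
  fan_offset i + 2 * a i <= fan_offset j.
Proof. by move=> ij; apply: fan_offset_leq => // l /ltn_trans; apply. Qed.

Lemma fan_offset_inj (i j : 'I_k) (x : 'I_(2 * a i)) (y : 'I_(2 * a j)) :
  fan_offset i + x = fan_offset j + y -> i = j.
Proof.
move=> eqo; apply: val_inj; have := ltn_ord x; have := ltn_ord y.
by case: (ltngtP i j) => // /fan_offset_lt; lia.
Qed.

(** The centre goes to [u], the last petal to [s] and all others to consecutive pieces of the first
    path. Only petal ends must be adjacent to [u]. The first petal has at least four vertices, so
    [x1] and [x2] are interior to it and may lie outside the neighbourhood of [u]. *)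
Lemma fan_embedding n (e : rel 'I_n) (i0 l : 'I_k) u x0 x1 x2 p s :
  symmetric e -> i0 = 0 :> nat -> l = k.-1 :> nat -> 1 < a i0 ->
  path e x0 [:: x1, x2 & p] -> sorted e s ->
  (size p + 3 = \sum_(i < k | i != l) 2 * a i) -> size s = 2 * a l ->
  uniq (u :: [:: x0, x1, x2 & p] ++ s) ->
  e u x0 -> all (e u) p -> all (e u) s ->
  contains_subgraph (@F_edge k a) e.
Proof.
move=> e_sym v0 vl a0 path1 path2 size1 size2 us eux0 eup eus.
pose s1 := [:: x0, x1, x2 & p]; rewrite -/s1 in us.
have ol : fan_offset l = size s1.
  have -> : size s1 = size p + 3 by rewrite addn3.
  rewrite size1; apply: eq_bigl => j.
  rewrite -(inj_eq val_inj) /= vl; have := ltn_ord j.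
  by case: (ltngtP j k.-1); lia.
have size12 : size (s1 ++ s) = fan_offset l + 2 * a l.
  by rewrite size_cat size2 ol.
have lt_size (i : 'I_k) : fan_offset i + 2 * a i <= size (s1 ++ s).
  rewrite size12; case: (eqVneq i l) => [-> //|il].
  have il' : i < l.
    by move: il; rewrite -(inj_eq val_inj) /= vl; have := ltn_ord i; lia.
  have := fan_offset_lt i l il'; lia.
pose pos (v : {i : 'I_k & 'I_(2 * a i)}) := fan_offset (tag v) + tagged v.
have pos_lt v : pos v < size (s1 ++ s).
  by case: v => i x; apply: leq_trans (lt_size i); rewrite /pos ltn_add2l.
have pos_inj : injective pos.
  move=> [i x] [j y]; rewrite /pos /= => eqo.
  have ij := fan_offset_inj i j x y eqo; subst j.
  by congr existT; apply: val_inj => /=; lia.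
pose f v := if v is Some w then nth u (s1 ++ s) (pos w) else u.
have u_notin : u \notin s1 ++ s by case/andP: us.
have u12 : uniq (s1 ++ s) by case/andP: us.
(* The excluded index is the junction of the two paths, which falls between two petals. *)
have adj i : i.+1 < size (s1 ++ s) -> i.+1 != size s1 ->
    e (nth u (s1 ++ s) i) (nth u (s1 ++ s) i.+1).
  move=> lti ni; have sorted1 : sorted e s1 := path1.
  rewrite !nth_cat; case: (ltnP i.+1 (size s1)) => le1.
    by rewrite (ltnW le1); apply: (elimT (sortedP u) sorted1).
  rewrite ifF; last by lia.
  rewrite subSn; last by lia.
  apply: (elimT (sortedP u) path2); move: lti; rewrite size_cat; lia.
have adju i : i < size (s1 ++ s) -> i != 1 -> i != 2 ->
    e u (nth u (s1 ++ s) i).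
  case: i => [//|[//|[//|i]]]; rewrite /= !ltnS => lti _ _.
  by rewrite (allP _ _ (mem_nth _ lti)) // all_cat eup.
have adj_step (v w : {i : 'I_k & 'I_(2 * a i)}) : tag v = tag w ->
    val (tagged w) = (val (tagged v)).+1 ->
    e (nth u (s1 ++ s) (pos v)) (nth u (s1 ++ s) (pos w)).
  case: v w => [i x] [j y] /= ij; subst j => /= yx.
  have -> : pos (existT _ i y) = (pos (existT _ i x)).+1.
    by rewrite /pos /= yx addnS.
  apply: adj; first by rewrite -addnS -yx; exact: (pos_lt (existT _ i y)).
  rewrite -ol /pos /= -addnS -yx; have lty := ltn_ord y.
  case: (ltngtP i l) => [/fan_offset_lt|/fan_offset_lt|/val_inj il]; try lia.
  by have -> : fan_offset i = fan_offset l by [rewrite il]; lia.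
have pos_end (v : {i : 'I_k & 'I_(2 * a i)}) : F_end v ->
    pos v = 0 \/ 2 < pos v.
  case: v => i; rewrite /F_end /pos /=; case: (eqVneq i i0) => [->|ii0] x.
    have -> : fan_offset i0 = 0 by rewrite /fan_offset big_pred0 // v0.
    by case/orP=> /eqP ->; [left | right; lia].
  have : i0 < i by move: ii0; rewrite -(inj_eq val_inj) /= v0; lia.
  by move/fan_offset_lt; right; lia.
have adj_end (v : {i : 'I_k & 'I_(2 * a i)}) : F_end v ->
    e u (nth u (s1 ++ s) (pos v)).
  by move/pos_end => posv; apply: adju (pos_lt v) _ _; lia.
exists f; split.
  move=> [v|] [w|] //=.
  - by move/eqP; rewrite nth_uniq // => /eqP /pos_inj ->.
  - by move=> fE; move: u_notin; rewrite -fE mem_nth.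
  - by move=> fE; move: u_notin; rewrite fE mem_nth.
move=> [v|] [w|] //=.
- case/andP=> /eqP tvw /orP[] /eqP stp; first exact: adj_step.
  by rewrite e_sym; apply: adj_step.
- by rewrite e_sym; apply: adj_end.
- exact: adj_end.
Qed.

End FanEmbedding.

(** * The neighbourhood of a vertex that is not the centre of a fan *)

Section CenterStructure.
Context {T : finType} (e : rel T).
Hypotheses (e_sym : symmetric e) (e_irr : irreflexive e).
Variables (u : T) (t b : nat).
Hypotheses (b_gt0 : 0 < b) (b_lt : b + 2 <= t).
Hypothesis no_fan : forall x0 x1 x2 p s,
  path e x0 [:: x1, x2 & p] -> sorted e s ->
  size p + 3 = 2 * (t - b) -> size s = 2 * b ->
  uniq (u :: [:: x0, x1, x2 & p] ++ s) ->
  e u x0 -> all (e u) p -> all (e u) s -> False.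

Let N := [set v | e u v].
Let W := ~: (u |: N).
Definition far_missing v := #|[set w in ~: (u |: [set v | e u v]) | ~~ e v w]|.
Let M := far_missing.
Hypothesis N_neq0 : N != set0.
Hypothesis N_dense : dense e (fun v => 4 * t - 5 + 2 * far_missing v) N.
Hypothesis T_large : 8 * t ^ 2 + 9 <= #|T| + 12 * t.

(** A single path on 2t vertices is cut into the two paths of [no_fan]; [m] leaves 2(t - b) vertices
    in the first piece, counting [x0], [x1] and [x2]. The path may leave the neighbourhood of [u] at
    [x1] and [x2]. *)
Lemma no_detour x0 x1 x2 p : path e x0 [:: x1, x2 & p] ->
  size p + 3 = 2 * t -> uniq (u :: [:: x0, x1, x2 & p]) ->
  e u x0 -> all (e u) p -> False.
Proof.
move=> pth sp us eux eup; pose m := 2 * (t - b) - 3.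
have pE := cat_take_drop m p.
have stk : size (take m p) = m by rewrite size_take; case: ltnP; lia.
apply: (no_fan x0 x1 x2 (take m p) (drop m p)) => //.
- move: pth; rewrite -{1}pE /= cat_path.
  by case/and3P=> -> -> /andP[->].
- move: pth; rewrite -{1}pE /= cat_path => /and3P[_ _ /andP[_]].
  exact: path_sorted.
- rewrite stk; lia.
- rewrite size_drop; lia.
- by rewrite /= pE.
- by move: eup; rewrite -{1}pE all_cat => /andP[].
- by move: eup; rewrite -{1}pE all_cat => /andP[].
Qed.

Lemma u_notin_N : u \notin N. Proof. by rewrite inE e_irr. Qed.

Lemma path_in_N s : path_in e N s -> [/\ sorted e s, uniq (u :: s) & all (e u) s].
Proof.
case/and3P=> ss us /allP aN.
have au : all (e u) s by apply/allP=> v /aN; rewrite inE.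
split=> //=; rewrite us andbT; apply/negP => /(allP au).
by rewrite e_irr.
Qed.

Lemma no_path_N s : path_in e N s -> size s <> 2 * t.
Proof.
case/path_in_N=> ss us eus sz; have : 2 < size s by rewrite sz; clear -b_lt; lia.
case: s ss us eus sz => [|x0 [|x1 [|x2 p]]] // pth us /and4P[eux _ _ eup] sp _.
by apply: (no_detour x0 x1 x2 p) => //; rewrite -sp addn3.
Qed.

Lemma no_two_paths_N s1 s2 : path_in e N s1 -> path_in e N s2 ->
  size s1 = 2 * (t - b) -> size s2 = 2 * b -> ~~ has [in s1] s2 -> False.
Proof.
move=> /path_in_N[ss1 /andP[us1 uu1] au1] /path_in_N[ss2 /andP[us2 uu2] au2].
move=> sz1 sz2 dis.
have us : uniq (u :: s1 ++ s2).
  rewrite cons_uniq mem_cat negb_or us1 us2 cat_uniq dis.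
  by rewrite -/(uniq s1) -/(uniq s2) in uu1 uu2; rewrite uu1 uu2.
have : 2 < size s1 by rewrite sz1; clear -b_lt; lia.
case: s1 ss1 au1 sz1 us {us1 uu1 dis} => [|x0 [|x1 [|x2 p]]] //.
move=> pth /and4P[eux _ _ eup] sp us _.
by apply: (no_fan x0 x1 x2 p s2) => //; rewrite -sp addn3.
Qed.

Lemma sum_deg_leq_card (S : {set T}) :
  \sum_(v in S) #|nbrs e S v| <= #|S| * (#|S| - 1).
Proof.
rewrite -sum_nat_const; apply: leq_sum => v vS.
suff: #|nbrs e S v| < #|S| by lia.
apply: proper_card; rewrite properE nbrs_subset; apply/subsetPn.
by exists v => //; rewrite inE e_irr andbF.
Qed.

Lemma card_N : #|N| + #|W| + 1 = #|T|.
Proof. by rewrite -(cardsC (u |: N)) -/W cardsU1 u_notin_N; lia. Qed.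

Variable K : {set T}.
Hypotheses (sKN : K \subset N) (K_neq0 : K != set0).
Hypothesis K_dense : dense e (fun v => 4 * t - 5 + 2 * M v) K.
Hypothesis K_conn : cut_connected e K.
Hypothesis K_deg : forall v, v \in K -> 4 * t - 5 + 2 * M v < 4 * #|nbrs e K v|.

Lemma K_dense_sum : #|K| * (4 * t - 5) + 2 * \sum_(v in K) M v
  <= 2 * \sum_(v in K) #|nbrs e K v|.
Proof. by move: K_dense; rewrite /dense big_split /= sum_nat_const -big_distrr. Qed.

(** The average degree in [K] is at least (4t - 5)/2 and at most |K| - 1. *)
Lemma core_large : 2 * t - 1 <= #|K|.
Proof.
have K0 : 0 < #|K| by rewrite card_gt0.
have := K_dense_sum; have := sum_deg_leq_card K; nia.
Qed.

Lemma core_deg v : v \in K -> t - 1 <= #|nbrs e K v|.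
Proof. by move/K_deg; lia. Qed.

(** Such a [K] would be nearly complete and spanned by a path that no vertex of [N :\: K] can join.
    If [W] is large, one of its vertices can be inserted into that path; if [W] is small, [N :\: K]
    is large and too sparse for [N] to be dense. *)
Lemma core_not_small : #|K| <> 2 * t - 1.
Proof.
move=> cK.
have sumM : \sum_(v in K) M v < t.
  have := K_dense_sum; have := sum_deg_leq_card K; rewrite cK; nia.
(* The other 2t - 2 vertices have degree sum at most (2t - 2)(2t - 3) among themselves, so density
   leaves at least (6t - 7)/4 > t - 1 for the degree of [v]. *)
have deg_t v : v \in K -> t <= #|nbrs e K v|.
  move=> vK; have sv : [set v] \subset K by rewrite sub1set.
  have := K_dense_sum; rewrite (sum_deg_split e e_sym sv) !big_set1.
  have -> : #|nbrs e [set v] v| = 0 by rewrite card_nbrs big_set1 e_irr.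
  have := sum_deg_leq_card (K :\ v); have := card_nbrs_split e v sv.
  have -> : #|nbrs e [set v] v| = 0 by rewrite card_nbrs big_set1 e_irr.
  have -> : #|K :\ v| = 2 * t - 2.
    by have := cardsD1 v K; rewrite vK cK; lia.
  by rewrite cK; nia.
have [||s pin ss] :=
  long_path e e_sym e_irr K (t - 1) (2 * t - 1) K_neq0 K_conn core_deg; [lia|lia|].
have /and3P[sps us /allP aK] := pin.
have sK : s =i K.
  apply: subset_cardP; first by rewrite (card_uniqP us) ss cK.
  exact/subsetP.
have pinN := path_in_sub e sKN pin.
(* The end degrees add up to at least 2t, so [path_extend] would absorb [y] and give a path on 2t
   vertices in [N]. *)
have no_edge x y : x \in K -> y \in N :\: K -> ~~ e x y.
  move=> xK /setDP[yN yK]; apply/negP => exy.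
  case: s pin ss sps us aK sK pinN => [|h p] pin /= sp sps us aK sK pinN.
    by clear -sp b_lt; lia.
  have [|||s' ss' pe] := path_extend e e_sym e_irr h p x y sps us _ _ exy.
  - by rewrite sK.
  - by rewrite sK.
  - have sub v : v \in h :: p -> t <= count (e v) (h :: p).
      rewrite sK => /deg_t le; apply: leq_trans le _.
      by apply: card_nbrs_count => // z; rewrite sK inE => /andP[].
    have dh := sub h (mem_head _ _); have dl := sub (last h p) (mem_last _ _).
    by apply: leq_trans (leq_add dh dl); clear -sp b_lt; lia.
  apply: (no_path_N s'); last by rewrite (perm_size pe) /=; clear -sp b_lt; lia.
  apply/and3P; split=> //; first by rewrite (perm_uniq pe) /= sK yK.
  rewrite (perm_all _ pe); apply/allP => z; rewrite in_cons sK.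
  by case/orP=> [/eqP ->|/(subsetP sKN)].
case: (leqP t #|W|) => cW.
  case: (boolP [exists w in W, [forall v in K, e v w]]) => [|no].
    case/exists_inP=> w wW /forall_inP ew.
    case/path_in_N: pinN; have : 1 < size s by rewrite ss; clear -b_lt; lia.
    case: s sK us ss {pin sps aK no_edge} => [|x0 [|x2 p]] //.
    move=> sK us sp _ /andP[e02 pth] /andP[uns uniqs] /and3P[eu0 eu2 eup].
    have wN : w \notin u |: N by move: wW; rewrite inE.
    have wK : w \notin [:: x0, x2 & p].
      rewrite sK; apply: contra wN => /(subsetP sKN) wN.
      by rewrite inE wN orbT.
    apply: (no_detour x0 w x2 p) => //=.
    - rewrite ew -?sK ?mem_head //= e_sym ew //.
      by rewrite -sK !inE eqxx orbT.
    - by move: sp => /= sp; clear -sp b_lt; lia.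
    - have pe : perm_eq [:: u, x0, w, x2 & p] [:: u, w, x0, x2 & p].
        by rewrite perm_cons; apply/permPl; exact: (perm_catCA [:: x0] [:: w]).
      move: wN; rewrite in_setU1 negb_or => /andP[wu _].
      suff: uniq [:: u, x0, w, x2 & p] by [].
      rewrite (perm_uniq pe) cons_uniq in_cons negb_or eq_sym wu uns.
      by rewrite cons_uniq wK us.
  (* Otherwise each vertex of [W] misses some vertex of [K]; double counting contradicts [sumM]. *)
  have : #|W| <= \sum_(v in K) M v.
    rewrite -sum1_card.
    have -> : \sum_(v in K) M v = \sum_(w in W) \sum_(v in K) ~~ e v w.
      rewrite exchange_big; apply: eq_bigr => v _.
      rewrite /M /far_missing -sum1_card big_mkcond [RHS]big_mkcond.
      apply: eq_bigr => w _; rewrite [in LHS]inE.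
      by case: (w \in ~: _); case: (e v w).
    apply: leq_sum => w wW; move: no; rewrite negb_exists_in => /forall_inP.
    move=> /(_ w wW); rewrite negb_forall_in => /exists_inP[v vK nev].
    by rewrite (bigD1 v) //= nev.
  by move/leq_ltn_trans => /(_ _ sumM); rewrite ltnNge cW.
pose S := N :\: K.
have cS : #|S| + #|K| = #|N|.
  by rewrite cardsD (setIidPr sKN) subnK // subset_leq_card.
have S0 : S != set0.
  rewrite -card_gt0; have := card_N; move: cS T_large; rewrite cK.
  by move: #|S| #|N| #|W| #|T| cW; clear -b_lt; nia.
(* The 2b vertices of the second path are available inside [K], disjoint from [S]. *)
have no_path_S s' : path_in e S s' -> size s' <> 2 * (t - b).
  move=> pin' ss'; have pinN' := path_in_sub e (subsetDl N K) pin'.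
  apply: (no_two_paths_N s' (take (2 * b) s) pinN') => //.
  - case/and3P: pinN => ? ? ?; apply/and3P; split.
    + exact: take_sorted.
    + exact: take_uniq.
    + by apply/allP=> z /mem_take; apply/allP.
  - by rewrite size_take ss; clear -b_lt; case: ltnP; lia.
  - apply/hasPn => z /mem_take; rewrite sK => zK; apply/negP => zs.
    by case/and3P: pin' => _ _ /allP/(_ z zs); rewrite inE zK.
have EG : 2 * \sum_(v in S) #|nbrs e S v| < #|S| * (2 * (2 * (t - b)) - 3).
  by apply: weak_erdos_gallai => //; clear -b_lt; lia.
move: N_dense; rewrite /dense (sum_deg_split e e_sym sKN) big_split /=.
rewrite sum_nat_const -/S -cS.
rewrite [X in _ + 2 * X + _]big1 => [|x xK]; last first.
  apply/eqP; rewrite cards_eq0; apply/eqP/setP=> y; rewrite [in LHS]inE in_set0.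
  by apply/negP=> /andP[yS exy]; case/negP: (no_edge x y xK yS).
(* In the doubled count each vertex of [S] thus falls short of 4t - 5 by 2 on average, while [K] has
   a surplus of at most 2t - 1. As |S| > n - 3t, [N] cannot be dense. *)
have EG' : 2 * \sum_(v in S) #|nbrs e S v| <= #|S| * (4 * t - 7).
  by apply: leq_trans (ltnW EG) _; rewrite leq_mul2l; clear -b_gt0; lia.
have := sum_deg_leq_card K; have := card_N; move: cS T_large EG'; rewrite cK.
move: (\sum_(v in K) #|nbrs e K v|) (\sum_(v in S) #|nbrs e S v|).
move: (\sum_(i in N) _) #|S| #|N| #|W| #|T| cW.
by clear -b_gt0 b_lt; nia.
Qed.

(** * Vertices joined to almost everything *)

Section Hub.
Variable E : {set T}.
Hypotheses (sEK : E \subset K) (card_E : #|E| = t - 1).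
Hypothesis card_K : 2 * t <= #|K|.
Hypothesis K_nbrs : forall x, x \in K :\: E -> nbrs e K x = E.

Let X := K :\: E.
Let Y := N :\: E.

Lemma card_X : t < #|X|.
Proof.
rewrite /X cardsD (setIidPr sEK) card_E; move: card_K.
by move: #|K|; clear -b_lt; lia.
Qed.

Lemma adj_EX x y : x \in E -> y \in X -> e x y.
Proof. by move=> + yX; rewrite -(K_nbrs y yX) inE e_sym => /andP[]. Qed.

Lemma XN x : x \in X -> x \in N.
Proof. by move/setDP=> [/(subsetP sKN)]. Qed.

Lemma EN x : x \in E -> x \in N.
Proof. by move/(subsetP sEK)/(subsetP sKN). Qed.

Lemma XnE x : x \in X -> x \notin E. Proof. by case/setDP. Qed.

Lemma path_in_alternate (es xs : seq T) : uniq es -> uniq xs ->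
  {subset es <= E} -> {subset xs <= X} -> size es = size xs ->
  path_in e N (alternate es xs).
Proof.
move=> ues uxs esE xsX sz; have pe := perm_alternate es xs sz.
apply/and3P; split.
- case: es xs {ues uxs pe} sz esE xsX => [|x es] [|y xs] //= [sz] esE xsX.
  have exy : e x y by apply: adj_EX; [apply: esE|apply: xsX]; apply: mem_head.
  rewrite exy; apply: path_alternate => // [a c aes cxs|].
    by apply: adj_EX; [apply: esE|apply: xsX]; rewrite in_cons ?aes ?cxs orbT.
  case: es {sz} esE => // a es esE _; rewrite e_sym; apply: adj_EX.
    by apply: esE; rewrite !inE eqxx orbT.
  by apply: xsX; apply: mem_head.
- rewrite (perm_uniq pe) cat_uniq ues uxs andbT; apply/hasPn => z /xsX zX.
  by apply: contra (XnE z zX) => /esE.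
- rewrite (perm_all _ pe) all_cat; apply/andP; split; apply/allP => z.
    by move/esE/EN.
  by move/xsX/XN.
Qed.

(** A vertex of [X] has degree exactly t - 1 in [K], and [K_deg] then reads 2 * [M x] < 1. *)
Lemma far_adj x w : x \in X -> w \in W -> e x w.
Proof.
move=> xX wW; have xK : x \in K by case/setDP: xX.
have : M x = 0.
  have := K_deg x xK; rewrite (K_nbrs x xX) card_E.
  by move: (M x); clear -b_lt; lia.
move/eqP; rewrite cards_eq0 => /eqP/setP/(_ w); rewrite [in LHS]inE in_set0.
by rewrite -/N -/W wW => /negbFE.
Qed.

(** A vertex [w] of [W] is adjacent to all of [X], so it can stand third in a path [e1], [x1], [w],
    [x2] that continues alternately through [E] and [X]. This uses t - 1 vertices of [E], t of [X]
    and [w], which [no_detour] forbids. *)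
Lemma far_empty : W = set0.
Proof.
apply/eqP/negPn/negP => /set0Pn[w wW].
have ses : size (enum E) = t - 1 by rewrite -cardE.
have sxs : size (take t (enum X)) = t by rewrite size_take -cardE card_X.
have es_big : 0 < size (enum E) by rewrite ses; clear -b_lt; lia.
have xs_big : 1 < size (take t (enum X)) by rewrite sxs; clear -b_lt; lia.
have esE : {subset enum E <= E} by move=> z; rewrite mem_enum.
have xsX : {subset take t (enum X) <= X} by move=> z /mem_take; rewrite mem_enum.
have ues := enum_uniq E; have uxs : uniq (take t (enum X)) by rewrite take_uniq ?enum_uniq.
case: (enum E) (take t (enum X)) ses sxs es_big xs_big esE xsX ues uxs
  => [//|e1 es] [//|x1 [//|x2 xs]] ses sxs _ _ esE xsX ues uxs.
have {ses sxs} [ses sxs] : size es = t - 2 /\ size xs = t - 2.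
  by move: ses sxs => /=; clear -b_lt; lia.
have pe : perm_eq [:: e1, x1, w, x2 & alternate es xs]
    (w :: [:: e1 & es] ++ [:: x1, x2 & xs]).
  apply/seq.permP => P.
  have /seq.permP/(_ P) h := perm_alternate es xs (etrans ses (esym sxs)).
  by rewrite /= !count_cat /= in h *; clear -h; lia.
have wuN : w \notin u |: N by move: wW; rewrite inE.
have e1E : e1 \in E by apply: esE; apply: mem_head.
have x1X : x1 \in X by apply: xsX; apply: mem_head.
have x2X : x2 \in X by apply: xsX; rewrite !inE eqxx orbT.
have inN z : z \in [:: e1 & es] ++ [:: x1, x2 & xs] -> z \in N.
  by rewrite mem_cat => /orP[/esE/EN|/xsX/XN].
apply: (no_detour e1 x1 w (x2 :: alternate es xs)).
- have cross : {in es & xs, forall x y, e x y}.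
    by move=> a c aes cxs; apply: adj_EX; [apply: esE|apply: xsX];
       rewrite !in_cons ?aes ?cxs !orbT.
  have esx2 : es <> [::] -> e x2 (head x2 es).
    case: es esE {pe inN cross ses ues} => // a es esE _; rewrite e_sym.
    by apply: adj_EX => //; apply: esE; rewrite !inE eqxx orbT.
  rewrite /= adj_EX // far_adj // e_sym far_adj //=.
  by rewrite path_alternate // ses.
- rewrite /= (perm_size (perm_alternate es xs (etrans ses (esym sxs)))).
  by rewrite size_cat ses sxs; clear -b_lt; lia.
- rewrite cons_uniq (perm_mem pe) (perm_uniq pe) in_cons negb_or.
  move: wuN; rewrite in_setU1 negb_or eq_sym => /andP[-> wN] /=.
  apply/andP; split; first by apply: contra u_notin_N => /inN.
  rewrite (contra (inN w) wN) /=; rewrite -[_ && _]/(uniq ((e1 :: es) ++ _)).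
  rewrite cat_uniq ues uxs andbT; apply/hasPn => z /xsX zX.
  by apply: contra (XnE z zX) => /esE.
- by move: (EN e1 e1E); rewrite inE.
- apply/allP=> z; rewrite in_cons (perm_mem (perm_alternate es xs (etrans ses (esym sxs)))).
  rewrite mem_cat => z_in; have : z \in N; last by rewrite inE.
  apply: inN; rewrite mem_cat !in_cons.
  by case/or3P: z_in => ->; rewrite ?orbT.
Qed.

(** Otherwise [y'], [y], [x] would start a path on 2t vertices of [N] that alternates between [E]
    and t - 1 vertices of [X] other than [y] and [y']. *)
Lemma no_edge_Y y y' x : y \in Y -> y' \in Y -> x \in E -> e y y' -> ~~ e y x.
Proof.
move=> yY y'Y xE eyy'; apply/negP => eyx.
pose Z := X :\ y :\ y'; pose es := enum (E :\ x).
pose xs := take (t - 1) (enum Z).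
have sxs : size xs = t - 1.
  have : t - 1 <= #|Z|.
    have := cardsD1 y X; have := cardsD1 y' (X :\ y); have := card_X.
    rewrite -/Z; move: #|X| #|X :\ y| #|Z| (y \in X) (y' \in _); clear.
    by move=> a c d [] []; lia.
  by rewrite size_take -cardE; case: ltngtP.
have xsZ z : z \in xs -> z \in Z by move/mem_take; rewrite mem_enum.
have xsX : {subset xs <= X} by move=> z /xsZ /setD1P[_ /setD1P[]].
have esE : {subset x :: es <= E}.
  by move=> z; rewrite in_cons mem_enum in_setD1 => /orP[/eqP ->|/andP[]].
have ses : size (x :: es) = t - 1.
  by rewrite /= -cardE -card_E (cardsD1 x E) xE.
have ues : uniq (x :: es) by rewrite /= mem_enum in_setD1 eqxx enum_uniq.
have uxs : uniq xs by rewrite take_uniq ?enum_uniq.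
clearbody es xs.
have pin := path_in_alternate (x :: es) xs ues uxs esE xsX (etrans ses (esym sxs)).
have pe := perm_alternate (x :: es) xs (etrans ses (esym sxs)).
have [yN yE] := setDP yY; have [y'N y'E] := setDP y'Y.
apply: (no_path_N [:: y', y & alternate (x :: es) xs]); last first.
  rewrite /= (perm_size pe) size_cat ses sxs; clear -b_lt; lia.
case/and3P: pin => sa ua aa; apply/and3P; split.
- rewrite /= e_sym eyy' /=; case: xs sxs sa {xsZ xsX uxs pe ua aa} => [|c xs] /=.
    by clear -b_lt; lia.
  by rewrite eyx.
- have yy' : y' != y by apply: contraTneq eyy' => ->; rewrite e_irr.
  have y'es : y' \notin x :: es by apply: contra y'E => /esE.
  have yes : y \notin x :: es by apply: contra yE => /esE.
  have y'xs : y' \notin xs by apply/negP => /xsZ; rewrite !inE eqxx.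
  have yxs : y \notin xs by apply/negP => /xsZ; rewrite !inE eqxx /= andbF.
  have alt_notin z : z \notin x :: es -> z \notin xs ->
      z \notin alternate (x :: es) xs.
    by move=> /negbTE zes /negbTE zxs; rewrite (perm_mem pe) mem_cat zes zxs.
  by rewrite 2!cons_uniq in_cons negb_or yy' !alt_notin.
- by rewrite /= y'N yN.
Qed.

Let R := [set y in Y | nbrs e Y y != set0].

Lemma RP y : y \in R -> y \in Y /\ exists2 y', y' \in R & e y y'.
Proof.
rewrite inE => /andP[yY /set0Pn[y']]; rewrite inE => /andP[y'Y eyy'].
split=> //; exists y' => //; rewrite inE y'Y /=.
by apply/set0Pn; exists y; rewrite inE yY e_sym.
Qed.

Lemma nbrs_ER y : y \in R -> nbrs e E y = set0.
Proof.
case/RP=> yY [y' /RP[y'Y _] eyy']; apply/setP=> x; rewrite [in LHS]inE in_set0.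
by apply/negP=> /andP[xE]; apply/negP; apply: no_edge_Y eyy'.
Qed.

Lemma nbrs_YR y : y \in Y -> nbrs e Y y = nbrs e R y.
Proof.
move=> yY; apply/setP=> z; rewrite [LHS]inE [RHS]inE.
apply: andb_id2r => eyz; rewrite [in RHS]inE; case zY: (z \in Y) => //=.
by apply/esym/set0Pn; exists y; rewrite inE yY e_sym.
Qed.

(** [R] is disjoint from [E] and [X], which carry an alternating path on 2(t - b) vertices. So [R]
    has no path on 2b vertices, and [weak_erdos_gallai] gives the factor 4b - 3 <= 4t - 11. *)
Lemma R_sparse : 2 * \sum_(v in R) #|nbrs e R v| <= #|R| * (4 * t - 11).
Proof.
case: (eqVneq R set0) => [->|R0]; first by rewrite big_set0 cards0.
have sRN : R \subset N by apply/subsetP=> y /RP[/setDP[]].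
have : 2 * \sum_(v in R) #|nbrs e R v| < #|R| * (2 * (2 * b) - 3).
  apply: weak_erdos_gallai => //; first by clear -b_gt0; lia.
  move=> s pin ss; pose es := take (t - b) (enum E).
  pose xs := take (t - b) (enum X).
  have ses : size es = t - b.
    rewrite size_take -cardE card_E; clear -b_gt0 b_lt; case: ltnP; lia.
  have sxs : size xs = t - b.
    rewrite size_take -cardE ifT //; have := card_X.
    by move: #|X|; clear; lia.
  have esE : {subset es <= E} by move=> z /mem_take; rewrite mem_enum.
  have xsX : {subset xs <= X} by move=> z /mem_take; rewrite mem_enum.
  have pe := perm_alternate es xs (etrans ses (esym sxs)).
  apply: (no_two_paths_N (alternate es xs) s) => //.
  - by apply: path_in_alternate; rewrite ?take_uniq ?enum_uniq ?ses.
  - exact: path_in_sub sRN pin.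
  - by rewrite (perm_size pe) size_cat ses sxs mul2n addnn.
  apply/hasPn => z zs; have zR : z \in R by case/and3P: pin => _ _ /allP/(_ z zs).
  rewrite /= (perm_mem pe) mem_cat negb_or; apply/andP; split.
    by apply/negP=> /esE zE; case/RP: zR => /setDP[_]; rewrite zE.
  apply/negP=> /xsX zX; have [x xE] : exists x, x \in E.
    by apply/set0Pn; rewrite -card_gt0 card_E; clear -b_lt; lia.
  have := nbrs_ER z zR; move/setP/(_ x); rewrite [in LHS]inE in_set0 xE.
  by rewrite e_sym (adj_EX x z).
move/ltnW/leq_trans; apply; rewrite leq_mul2l; apply/orP; right.
by clear -b_lt; lia.
Qed.

(** In the doubled density count of [N], with the edges between [E] and [Y] charged to [Y], a vertex
    of [Y :\: R] gains at most 4(t - 1) - (4t - 5) = 1, vertices of [R] lose on average at least (4t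
    - 5) - (4t - 11) = 6, and [E] gains nothing. Hence 6|R| <= |Y| - |R|. *)
Lemma card_R : 7 * #|R| <= #|T|.
Proof.
have sEN : E \subset N by apply/subsetP=> x /EN.
have sRY : R \subset Y by apply/subsetP=> y /RP[].
have cY : #|Y| + (t - 1) = #|N|.
  by rewrite cardsD (setIidPr sEN) card_E subnK // -card_E subset_leq_card.
have degEY x : x \in E -> #|nbrs e Y x| <= #|Y| - #|R|.
  move=> xE; have -> : #|Y| - #|R| = #|Y :\: R| by rewrite cardsD (setIidPr sRY).
  apply/subset_leq_card/subsetP=> y /[1!inE] /andP[yY exy].
  rewrite in_setD yY andbT; apply/negP => yR.
  have := nbrs_ER y yR; move/setP/(_ x); rewrite [in LHS]inE in_set0 xE.
  by rewrite e_sym exy.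
have sumEY : \sum_(x in E) #|nbrs e Y x| <= (t - 1) * (#|Y| - #|R|).
  by rewrite -card_E -sum_nat_const; apply: leq_sum.
have sumY : \sum_(y in Y) #|nbrs e Y y| = \sum_(y in R) #|nbrs e R y|.
  rewrite (sum_subset_split _ sRY) [X in _ + X]big1 ?addn0.
    by apply: eq_bigr => y /RP[yY _]; rewrite nbrs_YR.
  move=> y /setDP[yY yR]; apply/eqP; rewrite cards_eq0; apply: contraNT yR.
  by rewrite inE yY.
have sumN : #|N| * (4 * t - 5) <= 2 * \sum_(v in N) #|nbrs e N v|.
  move: N_dense; rewrite /dense big_split /= sum_nat_const; apply: leq_trans.
  exact: leq_addr.
move: sumN R_sparse; rewrite (sum_deg_split e e_sym sEN) -/Y sumY.
have := sum_deg_leq_card E; rewrite card_E; have := card_N.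
rewrite far_empty cards0; have := subset_leq_card sRY; move: cY sumEY.
(* This substitution turns the truncated differences into polynomials in [c]. *)
have [c tE] : exists c, t = c + 3 by exists (t - 3); clear -b_gt0 b_lt; lia.
have -> : t - 1 = c + 2 by clear -tE; lia.
have -> : 4 * t - 5 = 4 * c + 7 by clear -tE; lia.
have -> : 4 * t - 11 = 4 * c + 1 by clear -tE; lia.
have -> : c + 2 - 1 = c + 1 by clear; lia.
move: (\sum_(v in E) #|nbrs e E v|) (\sum_(v in E) #|nbrs e Y v|).
move: (\sum_(v in R) _) #|R| #|Y| #|N| #|T|.
move=> d cR cY' cN cT dE dEY cYE sEY sRY' cTE sE sN sR.
have [D YE] : exists D, cY' = cR + D by exists (cY' - cR); clear -sRY'; lia.
have sEY' : dEY <= (c + 2) * D by move: sEY; rewrite YE addKn.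
have cNE : cN = cR + D + (c + 2) by clear -YE cYE; lia.
rewrite cNE in sN cTE; clear -sEY' cTE sE sN sR; lia.
Qed.

Lemma hub_structure : exists A : {set T}, [/\ #|A| = t, u \in A,
  (forall v, v != u -> e u v) & forall y, y \notin A ->
  nbrs e (~: A) y = set0 \/
  nbrs e A y = [set u] /\ 7 * #|nbrs e (~: A) y| <= #|T|].
Proof.
have uE : u \notin E by apply: contra u_notin_N => /EN.
have eu v : v != u -> e u v.
  move=> vu; have := far_empty; rewrite /W => /setP/(_ v).
  by rewrite in_setC in_setU1 (negbTE vu) in_set0 inE => /negbFE.
have YE : ~: (u |: E) = Y.
  apply/setP=> y; rewrite in_setC in_setU1 in_setD negb_or [in RHS]inE andbC.
  case: (eqVneq y u) => [->|yu]; first by rewrite e_irr.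
  by rewrite eu.
exists (u |: E); split=> //.
- by rewrite cardsU1 uE card_E; clear -b_lt; lia.
- exact: setU11.
move=> y; rewrite YE -in_setC YE => yY.
case yR : (y \in R); last first.
  by left; apply/eqP; move: yR; rewrite inE yY => /negbFE.
right; split.
  apply/setP=> x; rewrite [LHS]inE in_setU1 in_set1.
  case: eqVneq => [->|xu] /=.
    by rewrite e_sym eu //; apply: contraNneq u_notin_N => <-; case/setDP: yY.
  by have := nbrs_ER y yR; move/setP/(_ x); rewrite [in LHS]inE in_set0.
apply: leq_trans card_R; rewrite leq_mul2l nbrs_YR //=.
exact: leq_card_nbrs.
Qed.

End Hub.
End CenterStructure.

(** * From fan-freeness and a degree bound to the structure around [u] *)

Lemma center_structure {T : finType} (e : rel T) (u : T) (t b : nat) :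
  symmetric e -> irreflexive e -> 0 < b -> b + 2 <= t ->
  (forall x0 x1 x2 p s,
    path e x0 [:: x1, x2 & p] -> sorted e s ->
    size p + 3 = 2 * (t - b) -> size s = 2 * b ->
    uniq (u :: [:: x0, x1, x2 & p] ++ s) ->
    e u x0 -> all (e u) p -> all (e u) s -> False) ->
  [set v | e u v] != set0 ->
  dense e (fun v => 4 * t - 5 + 2 * far_missing e u v) [set v | e u v] ->
  8 * t ^ 2 + 9 <= #|T| + 12 * t ->
  exists A : {set T}, [/\ #|A| = t, u \in A, (forall v, v != u -> e u v) &
    forall y, y \notin A -> nbrs e (~: A) y = set0 \/
      nbrs e A y = [set u] /\ 7 * #|nbrs e (~: A) y| <= #|T|].
Proof.
move=> e_sym e_irr b_gt0 b_lt no_fan N0 dN largeT.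
have [|K [[sKN K0 dK] [conn degK degK2]]] := dense_core e e_sym e_irr _ _ N0 dN.
  by move=> v _; clear -b_lt; lia.
have cK1 := core_large e e_irr u t b b_gt0 b_lt N0 dN largeT K sKN K0 dK.
have cK2 := core_not_small e e_sym e_irr u t b b_gt0 b_lt no_fan N0 dN largeT
  K sKN K0 dK conn degK.
have cK : 2 * t <= #|K| by clear -cK1 cK2; lia.
have [||||E [sEK cE KE]] :=
  large_core_structure e e_sym e_irr (t - 1) K _ conn
    (core_deg e u t b b_gt0 b_lt N0 dN largeT K sKN K0 dK degK).
- by clear -b_lt; lia.
(* The two weights amount to at least 8t - 10, so 4 times the degree sum exceeds 8t - 6, and the
   degree sum exceeds 2(t - 1). *)
- move=> x y xK yK exy; have := degK2 x y xK yK exy.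
  have K2 : 2 < #|K| by clear -b_lt cK; lia.
  by move/(_ K2); clear; lia.
- by clear -b_lt cK; lia.
- move=> s pin ss.
  apply: (no_path_N e e_irr u t b b_gt0 b_lt no_fan N0 dN largeT s).
    exact: path_in_sub sKN pin.
  by rewrite ss; clear -b_lt; lia.
exact: (hub_structure e e_sym e_irr u t b b_gt0 b_lt no_fan N0 dN largeT
  K sKN degK E sEK cE cK KE).
Qed.

(** The last petal plays the role of [s], so [b] is [a l]. As k >= 2, the first petal is a different
    one, and its parameter is at least 2, whence b + 2 <= t. *)
Lemma fan_free_center k (a : 'I_k -> nat) n (e : rel 'I_n) (u : 'I_n) :
  2 <= k -> (forall i : 'I_k, 1 <= a i) ->
  (forall i : 'I_k, val i = 0 -> 2 <= a i) ->
  let t := \sum_(i < k) a i in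
  8 * t ^ 2 + 9 <= n + 12 * t ->
  symmetric e -> irreflexive e -> H_free (@F_edge k a) e ->
  0 < deg e u ->
  dense e (fun v => 4 * t - 5 + 2 * far_missing e u v) [set v | e u v] ->
  exists A : {set 'I_n}, [/\ #|A| = t, u \in A, (forall v, v != u -> e u v) &
    forall y, y \notin A -> nbrs e (~: A) y = set0 \/
      nbrs e A y = [set u] /\ 7 * #|nbrs e (~: A) y| <= n].
Proof.
move=> k2 a1 a2 t largen e_sym e_irr Ffree du dN.
have [i0 i0E] : exists i0 : 'I_k, i0 = 0 :> nat.
  by exists (Ordinal (ltnW k2)).
have [l lE] : exists l : 'I_k, l = k.-1 :> nat.
  by have lk : k.-1 < k by [clear -k2; lia]; exists (Ordinal lk).
have a0 := a2 i0 i0E.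
have tE : t = a l + \sum_(i < k | i != l) a i by rewrite /t (bigD1 l).
have b_lt : a l + 2 <= t.
  rewrite tE leq_add2l (bigD1 i0) /=; first by clear -a0; lia.
  by rewrite -(inj_eq val_inj) /= i0E lE; clear -k2; lia.
have [|||A [cA uA eu str]] :=
  center_structure e u t (a l) e_sym e_irr (a1 l) b_lt _ _ dN.
- move=> x0 x1 x2 p s pth ss szp szs us eux eup eus; apply: Ffree.
  apply: (fan_embedding k a n e i0 l u x0 x1 x2 p s) => //.
  by rewrite szp tE addKn big_distrr.
- by rewrite -card_gt0.
- by rewrite card_ord.
by exists A; split=> // y /str; rewrite card_ord.
Qed.

(** A neighbour v of [u] is adjacent to [u], to its neighbours in [N], and to all of [W] but M v
    vertices, where |W| = n - 1 - deg u. So deg u + deg v = n + deg_N v - M v, and summing over [N]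
    gives density. *)
Lemma dense_of_deg_bound n (e : rel 'I_n) (u : 'I_n) t :
  symmetric e -> irreflexive e -> 2 < t ->
  (2 * n + 4 * t - 5) * deg e u <= 2 * \sum_(i | e u i) (deg e u + deg e i) ->
  dense e (fun v => 4 * t - 5 + 2 * far_missing e u v) [set v | e u v].
Proof.
move=> e_sym e_irr t2; set N := [set v | e u v]; set W := ~: (u |: N).
have dE v : deg e v = #|nbrs e setT v|.
  by apply: eq_card => w; rewrite !inE.
have uN : u \notin N by rewrite inE e_irr.
have cW : #|W| + (deg e u + 1) = n.
  have := cardsC (u |: N); rewrite -/W cardsU1 uN card_ord /deg -/N.
  by clear; lia.
have degN v : v \in N ->
    deg e u + deg e v + far_missing e u v = n + #|nbrs e N v|.
  move=> vN; have : #|nbrs e W v| + far_missing e u v = #|W|.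
    rewrite -[RHS](cardsID [set w | e v w]) /far_missing -/N -/W.
    congr (_ + _); apply: eq_card => w; first by rewrite !inE.
    by rewrite [LHS]inE [RHS]inE [in RHS]inE andbC.
  have : deg e v = 1 + #|nbrs e N v| + #|nbrs e W v|.
    rewrite dE (card_nbrs_split e v (subsetT (u |: N))) setTD -/W; congr (_ + _).
    rewrite !card_nbrs big_setU1 //=.
    by have -> : e v u = true by move: vN; rewrite inE e_sym.
  by move: cW; clear; lia.
have -> : \sum_(i | e u i) (deg e u + deg e i)
    = \sum_(i in N) (deg e u + deg e i) by apply: eq_bigl => i; rewrite inE.
have : \sum_(i in N) (deg e u + deg e i + far_missing e u i)
    = \sum_(i in N) (n + #|nbrs e N i|) by apply: eq_bigr.
rewrite /dense !big_split /= !sum_nat_const muln0.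
have -> : #|N| = deg e u by [].
have -> : 2 * n + 4 * t - 5 = 2 * n + (4 * t - 5) by clear -t2; lia.
rewrite mulnDl; move: (4 * t - 5) (deg e u) cW => c d cW.
move: (\sum_(i in N) deg e i) (\sum_(i in N) far_missing e u i).
by move: (\sum_(i in N) _); clear; lia.
Qed.

Local Open Scope ring_scope.

(** * Eigenvalues of the signless Laplacian and the complete split graph *)

Section Spectral.
Variables (R : realType) (n : nat).
Implicit Types (e : rel 'I_n) (A : {set 'I_n}) (y z : 'I_n -> R) (l q : R).

Lemma signlessQ_mulE e (x : 'rV[R]_n) j : symmetric e ->
  (x *m signlessQ R e) 0 j = \sum_(i | e j i) (x 0 j + x 0 i).
Proof.
move=> e_sym; rewrite mxE big_split /= sumr_const.
under eq_bigr do rewrite !mxE mulrDr.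
rewrite big_split /=; congr (_ + _).
  rewrite (bigD1 j) //= eqxx big1 ?addr0 => [|i /negbTE ->]; last by rewrite mulr0.
  by rewrite mulr_natr /deg cardsE.
rewrite [RHS]big_mkcond; apply: eq_bigr => i _; rewrite e_sym.
by case: ifP; rewrite (mulr1, mulr0).
Qed.

Lemma eigenvalue_signlessQP e l : symmetric e ->
  eigenvalue (signlessQ R e) l <->
  exists y, (exists j, y j != 0) /\
    forall j, \sum_(i | e j i) (y j + y i) = l * y j.
Proof.
move=> e_sym; split=> [/eigenvalueP[x xQ x0]|[y [[j yj] yQ]]].
  exists (x 0); split; first by apply/rV0Pn.
  by move=> j; rewrite -signlessQ_mulE // xQ mxE.
apply/eigenvalueP; exists (\row_i y i).
  apply/rowP=> i; rewrite signlessQ_mulE // !mxE -yQ.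
  by apply: eq_bigr => k _; rewrite !mxE.
by apply/rV0Pn; exists j; rewrite mxE.
Qed.

Lemma eigenvalue_iso e1 e2 l : symmetric e1 -> symmetric e2 ->
  graph_iso e1 e2 ->
  eigenvalue (signlessQ R e1) l -> eigenvalue (signlessQ R e2) l.
Proof.
move=> s1 s2 [p pE] /eigenvalue_signlessQP -/(_ s1) [y [[j yj] yQ]].
apply/eigenvalue_signlessQP => //; exists (fun i => y ((p^-1)%g i)); split.
  by exists (p j); rewrite permK.
move=> i; rewrite -yQ (reindex_inj (@perm_inj _ p)) /=.
by apply: eq_big => [k|k _]; rewrite ?permK // pE permKV.
Qed.

Lemma eigen_abs_le e l y : (forall j, \sum_(i | e j i) (y j + y i) = l * y j) ->
  forall j, l * `|y j| <= \sum_(i | e j i) (`|y j| + `|y i|).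
Proof.
move=> yQ j; apply: (@le_trans _ _ `|l * y j|).
  by rewrite normrM ler_wpM2r // ler_norm.
rewrite -yQ; apply: le_trans (ler_norm_sum _ _ _) _.
by apply: ler_sum => i _; apply: ler_normD.
Qed.

(* Taking u to maximise |y u| / deg u. *)
Lemma eigenvalue_deg_bound e l : symmetric e -> 0 < l ->
  eigenvalue (signlessQ R e) l ->
  exists2 u, (0 < deg e u)%N &
    l * (deg e u)%:R <= \sum_(i | e u i) ((deg e u)%:R + (deg e i)%:R).
Proof.
move=> e_sym l0 /eigenvalue_signlessQP -/(_ e_sym) [y [[j0 yj0] yQ]].
have yle := eigen_abs_le _ _ _ yQ.
pose g v : R := `|y v| / (deg e v)%:R.
have [u _ umax] : exists2 u, true & forall v, g v <= g u.
  by case: (@arg_maxP _ _ _ j0 xpredT g) => // u _ umax; exists u => // v; apply: umax.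
have ybound v : `|y v| <= g u * (deg e v)%:R.
  (* At an isolated vertex [g] is 0 because the inverse of 0 is 0, and [y v] vanishes since l >
     0. *)
  case: (posnP (deg e v)) => [dv|dv].
    rewrite dv mulr0 -(pmulr_rle0 _ l0); apply: le_trans (yle v) _.
    rewrite big1 // => i evi; move/eqP: dv; rewrite cards_eq0.
    by move/eqP/setP/(_ i); rewrite !inE evi.
  by rewrite -ler_pdivrMr ?ltr0n //; apply: umax.
have gu0 : 0 < g u.
  rewrite lt_def; apply/andP; split; last by rewrite divr_ge0.
  apply: contra yj0 => /eqP gu; rewrite -normr_le0.
  by have := ybound j0; rewrite gu mul0r.
have du : (0 < deg e u)%N.
  rewrite lt0n; apply: contraTneq gu0 => du.
  by rewrite /g du invr0 mulr0 ltxx.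
exists u => //; rewrite -(ler_pM2l gu0) mulrCA.
have -> : g u * (deg e u)%:R = `|y u|.
  by rewrite divfK // pnatr_eq0 -lt0n.
apply: le_trans (yle u) _; rewrite mulr_sumr; apply: ler_sum => i _.
by rewrite mulrDr; apply: lerD.
Qed.

(* Pairing y with the absolute value of an eigenvector turns the pointwise
   inequality into an equality. *)
Lemma subeigenvector_eq e l q y (u : 'I_n) : symmetric e ->
  (forall v, v != u -> e u v) -> (forall j, 0 < y j) ->
  (forall j, \sum_(i | e j i) (y j + y i) <= q * y j) ->
  eigenvalue (signlessQ R e) l -> q <= l ->
  forall j, \sum_(i | e j i) (y j + y i) = q * y j.
Proof.
move=> e_sym eu y0 yq /eigenvalue_signlessQP -/(_ e_sym) [x [[j0 xj0] xQ]] ql.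
pose z j : R := `|x j|; have zl : forall j, _ <= _ := eigen_abs_le _ _ _ xQ.
have z_ge0 j : 0 <= z j by apply: normr_ge0.
pose Q (w : 'I_n -> R) j := \sum_(i | e j i) (w j + w i).
have self_adj : \sum_j y j * Q z j = \sum_j z j * Q y j.
  rewrite /Q; under eq_bigr do rewrite mulr_sumr big_mkcond.
  under [RHS]eq_bigr do rewrite mulr_sumr big_mkcond.
  under eq_bigr do under eq_bigr do rewrite mulrDr.
  under [RHS]eq_bigr do under eq_bigr do rewrite mulrDr.
  have split_if (w1 w2 : 'I_n -> 'I_n -> R) :
      \sum_j \sum_i (if e j i then w1 j i + w2 j i else 0)
      = \sum_j \sum_i (if e j i then w1 j i else 0)
      + \sum_j \sum_i (if e j i then w2 j i else 0).
    rewrite -big_split; apply: eq_bigr => j _; rewrite -big_split.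
    by apply: eq_bigr => i _; case: (e j i); rewrite /= ?addr0.
  rewrite !split_if; congr (_ + _).
    by apply: eq_bigr => j _; apply: eq_bigr => i _; rewrite mulrC.
  rewrite exchange_big; apply: eq_bigr => j _; apply: eq_bigr => i _ /=.
  by rewrite e_sym mulrC.
have d1 j : 0 <= y j * (Q z j - l * z j).
  by rewrite mulr_ge0 ?(ltW (y0 j)) // subr_ge0; apply: zl.
have d2 j : 0 <= z j * (q * y j - Q y j).
  by rewrite mulr_ge0 // subr_ge0; apply: yq.
have d3 j : 0 <= (l - q) * (y j * z j).
  by rewrite mulr_ge0 ?subr_ge0 // mulr_ge0 // ltW.
(* The three sums are nonnegative and cancel because [Q] is self-adjoint, so each of them is
   zero. *)
have total : \sum_j y j * (Q z j - l * z j) + \sum_j z j * (q * y j - Q y j)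
    + \sum_j (l - q) * (y j * z j) = 0.
  have -> : \sum_j y j * (Q z j - l * z j)
      = \sum_j z j * Q y j - \sum_j l * (y j * z j).
    rewrite -self_adj -sumrB; apply: eq_bigr => j _; ring.
  rewrite -sumrB -!big_split; apply: big1 => j _ /=; ring.
have s1 : 0 <= \sum_j y j * (Q z j - l * z j) by apply: sumr_ge0.
have s2 : 0 <= \sum_j z j * (q * y j - Q y j) by apply: sumr_ge0.
have s3 : 0 <= \sum_j (l - q) * (y j * z j) by apply: sumr_ge0.
have t1 : \sum_j y j * (Q z j - l * z j) = 0 by lra.
have t2 : \sum_j z j * (q * y j - Q y j) = 0 by lra.
have Qz j : Q z j = l * z j.
  move/eqP: t1; rewrite psumr_eq0 // => /allP/(_ j (mem_index_enum j)).
  by rewrite /= mulf_eq0 gt_eqF //= subr_eq0 => /eqP.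
(* A zero of [z] spreads to all neighbours. Through [u], adjacent to everything, it would reach
   every vertex, so [z] has no zero. *)
have z_sum0 j : z j = 0 -> forall i, e j i -> z i = 0.
  move=> zj i eji; have /eqP := Qz j; rewrite zj mulr0 psumr_eq0; last first.
    by move=> k _; rewrite addr_ge0.
  move/allP/(_ i (mem_index_enum i)); rewrite eji /= zj add0r.
  by move/eqP.
have zu : z u != 0.
  apply/eqP => zu; case/negP: xj0; rewrite -normr_eq0.
  case: (eqVneq j0 u) => [->|j0u]; first by apply/eqP.
  by apply/eqP; apply: (z_sum0 u zu); apply: eu.
move=> j; have zj : z j != 0.
  case: (eqVneq j u) => [->//|ju]; apply: contra zu => /eqP zj.
  by apply/eqP; apply: (z_sum0 j zj); rewrite e_sym eu.
move/eqP: t2; rewrite psumr_eq0 // => /allP/(_ j (mem_index_enum j)).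
by rewrite /= mulf_eq0 (negbTE zj) /= subr_eq0 => /eqP.
Qed.

Definition two_valued (A : {set 'I_n}) (c d : R) (i : 'I_n) : R :=
  if i \in A then c else d.

Lemma sum_two_valued e A (c d : R) j : let w := two_valued A c d in
  \sum_(i | e j i) (w j + w i) =
  (w j + c) * #|nbrs e A j|%:R + (w j + d) * #|nbrs e (~: A) j|%:R.
Proof.
move=> w; rewrite (bigID (fun i => i \in A)) /=; congr (_ + _).
  rewrite (eq_bigr (fun=> w j + c)) => [|i /andP[_ iA]]; last by rewrite /w /two_valued iA.
  rewrite sumr_const mulr_natr; congr (_ *+ _); apply: eq_card => i.
  by rewrite [LHS]inE [RHS]inE andbC.
rewrite (eq_bigr (fun=> w j + d)) => [|i /andP[_ iA]]; last first.
  by rewrite /w /two_valued (negbTE iA).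
rewrite sumr_const mulr_natr; congr (_ *+ _); apply: eq_card => i.
by rewrite [LHS]inE [RHS]inE in_setC andbC.
Qed.

(* q is the larger root of the characteristic polynomial of the quotient of
   Q(S_{n,t}) by its two vertex classes. *)
Lemma split_root (t : nat) : (2 < t)%N -> (8 * t ^ 2 + 9 <= n + 12 * t)%N ->
  exists q : R, [/\ q * q = (n%:R + 2 * t%:R - 2) * q - 2 * t%:R * (t%:R - 1),
    n%:R <= q & 2 * n%:R + 4 * t%:R - 5 <= 2 * q].
Proof.
move=> t2 large; pose B : R := n%:R + 2 * t%:R - 2.
pose D := B * B - 8 * t%:R * (t%:R - 1).
have t3 : 3 <= t%:R :> R by rewrite ler_nat.
have large' : 8 * (t%:R * t%:R) + 9 <= n%:R + 12 * t%:R :> R.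
  by rewrite -!natrM -!natrD ler_nat.
have tt : 3 * t%:R <= t%:R * t%:R :> R by rewrite ler_wpM2r.
have B1 : 0 <= B - 1 by rewrite /B; lra.
(* The bound on the order enters here as 2B - 1 >= 8t(t - 1). It yields 2q >= 2B - 1 = 2n + 4t -
   5. *)
have D1 : (B - 1) ^+ 2 <= D by rewrite /D expr2 /B; lra.
have D0 : 0 <= D by apply: le_trans D1; apply: sqr_ge0.
have sD : B - 1 <= Num.sqrt D.
  by rewrite -(ger0_norm B1) -sqrtr_sqr ler_wsqrtr.
have sqD : Num.sqrt D * Num.sqrt D = D by rewrite -expr2 sqr_sqrtr.
exists ((B + Num.sqrt D) / 2); split.
- have -> : (B + Num.sqrt D) / 2 * ((B + Num.sqrt D) / 2)
      = (B * B + 2 * (B * Num.sqrt D) + Num.sqrt D * Num.sqrt D) / 4 by field.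
  by rewrite sqD {2}/D -/B; field.
- by rewrite /B in sD *; lra.
- by rewrite /B in sD *; lra.
Qed.

Section TestVector.
Variables (e : rel 'I_n) (t : nat) (A : {set 'I_n}) (q : R).
Hypotheses (card_A : #|A| = t) (t_gt2 : (2 < t)%N).
Hypothesis q_root :
  q * q = (n%:R + 2 * t%:R - 2) * q - 2 * t%:R * (t%:R - 1).

Let w := two_valued A (q - t%:R) t%:R.

(** [w] is the Perron vector of the complete split graph with clique [A]; the defect measures the
    edges of that graph missing at [j]. *)
Lemma test_vector_in j : j \in A -> q * w j - \sum_(i | e j i) (w j + w i) =
  2 * (q - t%:R) * (t%:R - 1 - #|nbrs e A j|%:R)
  + q * (n%:R - t%:R - #|nbrs e (~: A) j|%:R).
Proof.
move=> jA; rewrite sum_two_valued /w /two_valued jA.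
move: (#|nbrs e A j|%:R : R) (#|nbrs e (~: A) j|%:R : R) => x y.
by apply/eqP; rewrite -subr_eq0; apply/eqP; move: q_root; lra.
Qed.

Lemma test_vector_out j : j \notin A ->
  q * w j - \sum_(i | e j i) (w j + w i) =
  q * (t%:R - #|nbrs e A j|%:R) - 2 * t%:R * #|nbrs e (~: A) j|%:R.
Proof.
move=> jA; rewrite sum_two_valued /w /two_valued (negbTE jA); ring.
Qed.

End TestVector.

Lemma nbrs_in_le e A j : irreflexive e -> j \in A -> (#|nbrs e A j| <= #|A| - 1)%N.
Proof.
move=> e_irr jA; rewrite (cardsD1 j A) jA addKn.
apply/subset_leq_card/subsetP=> i; rewrite inE in_setD1 => /andP[-> eji].
by rewrite andbT; apply: contraTneq eji => ->; rewrite e_irr.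
Qed.

Lemma card_compl (A : {set 'I_n}) : #|~: A|%:R = n%:R - #|A|%:R :> R.
Proof.
have /(congr1 (fun m => m%:R : R)) := cardsC A.
by rewrite card_ord natrD => <-; rewrite addrC addKr.
Qed.

Definition complete_split e A :=
  forall i j, e i j = (i != j) && ((i \in A) || (j \in A)).

Lemma complete_split_nbrs e A j : complete_split e A ->
  nbrs e A j = A :\ j /\ nbrs e (~: A) j = if j \in A then ~: A else set0.
Proof.
move=> eA; split; apply/setP => i.
  rewrite inE in_setD1 eA (eq_sym j).
  by case: (i \in A); rewrite ?orbT ?andbT ?andbF.
rewrite inE eA in_setC; case: (boolP (j \in A)) => jA; rewrite ?in_setC ?in_set0.
  by case: (boolP (i \in A)) => // iA; rewrite andbT; apply: contraNneq iA => <-.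
by case: (i \in A); rewrite ?andbF.
Qed.

Lemma complete_split_sym e A : complete_split e A -> symmetric e.
Proof. by move=> eA i j; rewrite !eA eq_sym orbC. Qed.

Lemma complete_split_eigenvalue e A (q : R) : complete_split e A ->
  (0 < #|A|)%N -> #|A|%:R < q ->
  q * q = (n%:R + 2 * #|A|%:R - 2) * q - 2 * #|A|%:R * (#|A|%:R - 1) ->
  eigenvalue (signlessQ R e) q.
Proof.
move=> eA A0 ltAq qE.
apply/eigenvalue_signlessQP; first exact: complete_split_sym eA.
exists (two_valued A (q - #|A|%:R) #|A|%:R); split.
  have [j jA] := card_gt0P A0; exists j.
  by rewrite /two_valued jA subr_eq0 gt_eqF.
move=> j; apply/esym/eqP; rewrite -subr_eq0; apply/eqP.
have [nA nC] := complete_split_nbrs e A j eA.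
case: (boolP (j \in A)) => jA.
  rewrite (test_vector_in e #|A| A q qE j jA) nA nC jA card_compl.
  have := cardsD1 j A; rewrite jA => ->; rewrite natrD -[true%:R]/(1 : R); ring.
rewrite (test_vector_out e #|A| A q j jA) nA nC (negbTE jA) cards0.
by have := cardsD1 j A; rewrite (negbTE jA) add0n => <-; rewrite subrr !mulr0 subrr.
Qed.

Lemma complete_split_iso e A : complete_split e A ->
  graph_iso e (@S_edge n #|A|).
Proof.
(* Numbering the vertices of [A] first sends [A] to the indices below its size. *)
move=> eA; pose s := enum A ++ enum (~: A).
have us : uniq s.
  rewrite cat_uniq !enum_uniq andbT /=; apply/hasPn => i.
  by rewrite !mem_enum in_setC.
have mem_s i : i \in s by rewrite mem_cat !mem_enum in_setC orbN.
have sz : size s = n.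
  by rewrite -(card_uniqP us) -[RHS]card_ord; apply: eq_card => i; rewrite mem_s.
have idx i : (index i s < n)%N by rewrite -[X in (_ < X)%N]sz index_mem.
have f_inj : injective (fun i => Ordinal (idx i)).
  by move=> i j [] /(congr1 (nth i s)); rewrite !nth_index.
have idxA i : (index i s < #|A|)%N = (i \in A).
  rewrite index_cat mem_enum; case: ifP => iA; last by rewrite -cardE ltnNge leq_addr.
  by rewrite cardE index_mem mem_enum.
exists (perm f_inj) => i j; rewrite eA /S_edge !permE /= !idxA.
by rewrite -(inj_eq f_inj).
Qed.

Lemma complete_split_S_edge t : complete_split (@S_edge n t) [set i : 'I_n | (i < t)%N].
Proof. by move=> i j; rewrite !inE. Qed.

Lemma card_ord_lt t : (t <= n)%N -> #|[set i : 'I_n | (i < t)%N]| = t.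
Proof.
move=> tn; rewrite cardE -(size_map val) -[RHS](size_iota 0); apply: perm_size.
apply: uniq_perm; rewrite ?iota_uniq ?map_inj_uniq ?enum_uniq //; first exact: val_inj.
move=> i; rewrite mem_iota; apply/mapP/idP => [[k kA ->]|].
  by move: kA; rewrite mem_enum inE.
move=> /= it; exists (Ordinal (leq_trans it tn)) => //.
by rewrite mem_enum inE.
Qed.

Section Extremal.
Variables (e : rel 'I_n) (t : nat) (A : {set 'I_n}) (u : 'I_n) (q l : R).
Hypotheses (e_sym : symmetric e) (e_irr : irreflexive e).
Hypotheses (card_A : #|A| = t) (uA : u \in A) (t_gt2 : (2 < t)%N) (tn : (t < n)%N).
Hypothesis eu : forall v : 'I_n, v != u -> e u v.
Hypothesis eA : forall j, j \notin A -> nbrs e (~: A) j = set0 \/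
  nbrs e A j = [set u] /\ (7 * #|nbrs e (~: A) j| <= n)%N.
Hypothesis q_root :
  q * q = (n%:R + 2 * t%:R - 2) * q - 2 * t%:R * (t%:R - 1).
Hypothesis q_gen : n%:R <= q.
Hypotheses (l_eig : eigenvalue (signlessQ R e) l) (ql : q <= l).

Let w := two_valued A (q - t%:R) t%:R.

(** With b the number of neighbours of [j] outside [A], 7b <= n <= q gives 2tb <= 2tq/7, which is
    less than (t - 1)q because t >= 3. *)
Lemma test_vector_out_gt0 j : j \notin A -> nbrs e A j = [set u] ->
  (7 * #|nbrs e (~: A) j| <= n)%N ->
  0 < q * (t%:R - #|nbrs e A j|%:R) - 2 * t%:R * #|nbrs e (~: A) j|%:R.
Proof.
move=> jA ->; rewrite cards1 -(ler_nat R) natrM.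
move: (#|nbrs e (~: A) j|%:R : R) => b b7.
have t3 : 3 <= t%:R :> R by rewrite ler_nat.
have b7q : 7 * b <= q by apply: le_trans b7 q_gen.
have n0 : 0 < n%:R :> R by rewrite ltr0n (leq_ltn_trans _ tn).
have q0 : 0 < q by apply: lt_le_trans q_gen.
have : 2 * t%:R * (7 * b) <= 2 * t%:R * q by rewrite ler_wpM2l //; lra.
have : 3 * q <= t%:R * q by rewrite ler_pM2r.
rewrite -[1%:R]/(1 : R); lra.
Qed.

(** The defects of [w] are nonnegative, so [subeigenvector_eq] makes them all zero. At a vertex of
    [A] both summands vanish, which forces all possible edges there. Outside [A], having [u] as only
    neighbour in [A] would give a positive defect, so no edge remains outside [A]. *)
Lemma extremal_complete_split : complete_split e A.
Proof.
have t3 : 3 <= t%:R :> R by rewrite ler_nat.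
have tqR : t%:R < q by apply: lt_le_trans q_gen; rewrite ltr_nat.
have q0 : 0 < q by lra.
have w0 j : 0 < w j by rewrite /w /two_valued; case: ifP => _; lra.
have alpha_le j : #|nbrs e A j|%:R <= t%:R :> R.
  by rewrite ler_nat -card_A leq_card_nbrs.
have alpha_in j : j \in A -> #|nbrs e A j|%:R <= t%:R - 1 :> R.
  move=> jA; rewrite lerBrDr natr1 ler_nat -card_A.
  have := nbrs_in_le e A j e_irr jA.
  by have : (0 < #|A|)%N by [apply/card_gt0P; exists j]; clear; lia.
have beta_le j : #|nbrs e (~: A) j|%:R <= n%:R - t%:R :> R.
  by rewrite -card_A -card_compl ler_nat leq_card_nbrs.
have wq j : \sum_(i | e j i) (w j + w i) <= q * w j.
  rewrite -subr_ge0; case: (boolP (j \in A)) => jA.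
    rewrite (test_vector_in e t A q q_root j jA).
    have := alpha_in j jA; have := beta_le j => bj aj.
    by apply: addr_ge0; apply: mulr_ge0; lra.
  rewrite (test_vector_out e t A q j jA); case: (eA j jA) => [-> | [nu b7]].
    by rewrite cards0 mulr0 subr0 mulr_ge0 ?subr_ge0 //; lra.
  by apply: ltW; apply: test_vector_out_gt0.
have weq := subeigenvector_eq e l q w u e_sym eu w0 wq l_eig ql.
have inA j : j \in A -> #|nbrs e (~: A) j| = #|~: A|.
  move=> jA; have := test_vector_in e t A q q_root j jA.
  rewrite -/w weq subrr => eq0.
  have : 0 <= 2 * (q - t%:R) * (t%:R - 1 - #|nbrs e A j|%:R).
    by apply: mulr_ge0; rewrite ?subr_ge0 ?alpha_in //; lra.
  have : 0 <= q * (n%:R - t%:R - #|nbrs e (~: A) j|%:R).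
    by apply: mulr_ge0; rewrite ?subr_ge0 ?beta_le //; lra.
  move=> h1 h2; have /eqP : q * (n%:R - t%:R - #|nbrs e (~: A) j|%:R) = 0 by lra.
  rewrite mulf_eq0 gt_eqF //= subr_eq0 -card_A -card_compl eqr_nat.
  by move/eqP.
have inA' j : j \in A -> #|nbrs e A j| = (t - 1)%N.
  move=> jA; have := test_vector_in e t A q q_root j jA.
  rewrite -/w weq subrr inA // card_compl card_A subrr mulr0 addr0.
  move/esym/eqP; rewrite !mulf_eq0 pnatr_eq0 /= !subr_eq0 [q == _]gt_eqF //=.
  move/eqP => h; apply/eqP; rewrite -(eqr_nat R) natrB; last by lia.
  by rewrite h.
have outA j : j \notin A -> nbrs e (~: A) j = set0 /\ #|nbrs e A j| = t.
  move=> jA; have := test_vector_out e t A q j jA; rewrite -/w weq subrr.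
  case: (eA j jA) => [nb0|[nu b7]] eq0; last first.
    by have := test_vector_out_gt0 j jA nu b7; rewrite -eq0 ltxx.
  split=> //; move/esym/eqP: eq0; rewrite nb0 cards0 mulr0 subr0.
  by rewrite mulf_eq0 gt_eqF //= subr_eq0 eqr_nat => /eqP.
have sub_eq (S B : {set 'I_n}) j : nbrs e S j \subset B -> #|nbrs e S j| = #|B| ->
    nbrs e S j = B.
  by move=> sub c; apply/eqP; rewrite eqEcard sub c leqnn.
have nbrsE (S : {set 'I_n}) j i : i \in S -> e j i = (i \in nbrs e S j) by rewrite inE => ->.
move=> i j; case: (boolP (i \in A)) => iA; last first.
  have [nC nA] := outA i iA; case: (boolP (j \in A)) => jA /=.
    rewrite andbT (nbrsE A) // (sub_eq A A i (nbrs_subset _ _ _)) ?card_A // jA.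
    by apply/esym; apply: contraNneq iA => ->.
  by rewrite andbF (nbrsE (~: A)) ?in_setC // nC in_set0.
rewrite andbT; case: (boolP (j \in A)) => jA.
  rewrite (nbrsE A) // (sub_eq A (A :\ i) i).
  - by rewrite in_setD1 jA andbT eq_sym.
  - apply/subsetP=> k; rewrite inE in_setD1 => /andP[-> eik]; rewrite andbT.
    by apply: contraTneq eik => ->; rewrite e_irr.
  - by rewrite inA' // -card_A (cardsD1 i A) iA addKn.
rewrite (nbrsE (~: A)) ?in_setC // (sub_eq _ (~: A) i (nbrs_subset _ _ _)) ?inA //.
rewrite in_setC jA; apply/esym; by apply: contraNneq jA => <-.
Qed.

End Extremal.
End Spectral.

(** * Comparison of the two largest eigenvalues *)

Lemma fan_free_iso (R : realType) (k : nat) (a : 'I_k -> nat) (n : nat)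
  (e : rel 'I_n) (q l : R) :
  (2 <= k)%N ->
  (forall i : 'I_k, (1 <= a i)%N) ->
  (forall i : 'I_k, val i = 0%N -> (2 <= a i)%N) ->
  let t := (\sum_(i < k) a i)%N in
  (2 < t)%N -> (8 * t ^ 2 + 9 <= n + 12 * t)%N ->
  symmetric e -> irreflexive e -> H_free (@F_edge k a) e ->
  q * q = (n%:R + 2 * t%:R - 2) * q - 2 * t%:R * (t%:R - 1) ->
  n%:R <= q -> 2 * n%:R + 4 * t%:R - 5 <= 2 * q ->
  eigenvalue (signlessQ R e) l -> q <= l -> graph_iso e (@S_edge n t).
Proof.
move=> k2 a1 a2 t t2 large e_sym e_irr Ffree qE nq qB l_eig ql.
have tn : (t < n)%N by clear -t2 large; nia.
have l0 : 0 < l.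
  by apply: lt_le_trans (le_trans nq ql); rewrite ltr0n (leq_ltn_trans _ tn).
have [u du lu] := eigenvalue_deg_bound R n e l e_sym l0 l_eig.
have deg_nat : ((2 * n + 4 * t - 5) * deg e u
    <= 2 * \sum_(i | e u i) (deg e u + deg e i))%N.
  rewrite -(ler_nat R) !natrM natrB; last by clear -t2; lia.
  rewrite natrD !natrM natr_sum.
  have -> : \sum_(i | e u i) (deg e u + deg e i)%:R
      = \sum_(i | e u i) ((deg e u)%:R + (deg e i)%:R) :> R.
    by apply: eq_bigr => i _; rewrite natrD.
  have d0 : 0 <= (deg e u)%:R :> R by [].
  have : (2 * n%:R + 4 * t%:R - 5) * (deg e u)%:R <= 2 * q * (deg e u)%:R.
    by rewrite ler_wpM2r.
  have : q * (deg e u)%:R <= l * (deg e u)%:R by rewrite ler_wpM2r.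
  by move: lu; lra.
have dN := dense_of_deg_bound n e u t e_sym e_irr t2 deg_nat.
have [A [cA uA eu eA]] :=
  fan_free_center k a n e u k2 a1 a2 large e_sym e_irr Ffree du dN.
rewrite -[t]cA; apply: complete_split_iso.
exact: (extremal_complete_split R n e t A u q l).
Qed.

Theorem theorem1p7 (R : realType) (k : nat) (a : 'I_k -> nat)
  (n : nat) (e : rel 'I_n) :
  (2 <= k)%N ->
  (forall i j : 'I_k, (val i <= val j)%N -> (a j <= a i)%N) ->
  (forall i : 'I_k, (1 <= a i)%N) ->
  (forall i : 'I_k, val i = 0%N -> (2 <= a i)%N) ->
  let t := (\sum_(i < k) a i)%N in
  (8 * t ^ 2 + 9 <= n + 12 * t)%N ->
  simple_graph e ->
  H_free (@F_edge k a) e ->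
  forall qG qS : R, is_q e qG -> is_q (@S_edge n t) qS ->
    qG <= qS /\ (qG = qS <-> graph_iso e (@S_edge n t)).
Proof.
move=> k2 _ a1 a2 t large [e_sym e_irr] Ffree qG qS [qG_eig qG_max] [qS_eig qS_max].
have t2 : (2 < t)%N.
  rewrite /t (bigD1 (Ordinal (ltnW k2))) //= (bigD1 (Ordinal k2)) //=.
  have := a2 (Ordinal (ltnW k2)) erefl; have := a1 (Ordinal k2).
  by clear; lia.
have tn : (t < n)%N by clear -t2 large; nia.
have [q [qE nq qB]] := split_root R n t t2 large.
have S_split := complete_split_S_edge n t.
have S_sym := complete_split_sym n _ _ S_split.
have qS_ge : q <= qS.
  apply: qS_max; apply: (complete_split_eigenvalue R n _ _ q S_split);
    rewrite card_ord_lt ?(ltnW tn) //; first exact: ltn_trans t2.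
  by apply: lt_le_trans nq; rewrite ltr_nat.
have iso_of_le : q <= qG -> graph_iso e (@S_edge n t).
  exact: (fan_free_iso R k a n e q qG).
have le_of_iso : graph_iso e (@S_edge n t) -> qG <= qS.
  by move=> iso; apply: qS_max; apply: eigenvalue_iso iso qG_eig.
(* The root [q] separates two cases: from [q] upwards the graph is S_{n,t} itself, and below [q] the
   bound q <= [qS] suffices. *)
have le_GS : qG <= qS.
  case: (lerP q qG) => [/iso_of_le /le_of_iso //|/ltW qGq].
  exact: le_trans qGq qS_ge.
split=> //; split=> [qGS|iso]; first by apply: iso_of_le; rewrite qGS.
apply/eqP; rewrite eq_le le_GS /=; apply: qG_max.
apply: (eigenvalue_iso R n (@S_edge n t) e) => //.
case: iso => p pE; exists (p^-1)%g => x y.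
by rewrite pE !permKV.
Qed.
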